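(* Let $d\ge2$, $\ell\ge0$, $0<R_1<R_2$, $\alpha_1,\alpha_2>0$, and let $k^{(1)}=k_{\ell,p}(\alpha_1,\alpha_2)$, $k^{(2)}=k_{\ell,q}(\alpha_1,\alpha_2)$ with $p\neq q$ be two resonances of the same mode, with boundary masses $b_i^{(1)}=b_i(\ell,p;\alpha_1,\alpha_2)$, $b_i^{(2)}=b_i(\ell,q;\alpha_1,\alpha_2)$, $i=1,2$. The two-frequency map $(\alpha_1,\alpha_2)\mapsto(k^{(1)},k^{(2)})$ is locally invertible if and only if $$b_1^{(1)}b_2^{(2)}\neq b_2^{(1)}b_1^{(2)} .$$ If measured frequencies satisfy $\|\delta k\|_2\le\eta$ and $$J=\begin{pmatrix}\dfrac{b_1^{(1)}}{2k^{(1)}}&\dfrac{b_2^{(1)}}{2k^{(1)}}\\[8pt]\dfrac{b_1^{(2)}}{2k^{(2)}}&\dfrac{b_2^{(2)}}{2k^{(2)}}\end{pmatrix}$$ is invertible, then the first-order recovery error $\delta\alpha$ obeys $$\|\delta\alpha\|_2\le\|J^{-1}\|_2\,\eta .$$ For isotropic relative frequency noise $|\delta k^{(j)}|\le\varepsilon|k^{(j)}|$, $j=1,2$, one may take $\eta=\varepsilon\sqrt{(k^{(1)})^2+(k^{(2)})^2}$.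
   Context: $k_{\ell,1}(\alpha_1,\alpha_2)<k_{\ell,2}(\alpha_1,\alpha_2)<\cdots$ are the positive numbers $k$ for which $\lambda=k^2$ is an eigenvalue of $$u''+\frac{d-1}{r}u'+\Bigl(\lambda-\frac{\ell(\ell+d-2)}{r^2}\Bigr)u=0\ \text{ on }(R_1,R_2),\qquad -u'(R_1)+\alpha_1u(R_1)=0,\quad u'(R_2)+\alpha_2u(R_2)=0.$$ The boundary masses are $b_i(\ell,p;\alpha_1,\alpha_2)=R_i^{d-1}|u(R_i)|^2$, $i=1,2$, where $u$ is the eigenfunction for $k_{\ell,p}$ normalised by $\int_{R_1}^{R_2}|u|^2r^{d-1}dr=1$. The matrix $J$ is the Jacobian of the map $(\alpha_1,\alpha_2)\mapsto(k^{(1)},k^{(2)})$, so that $\delta k=J\,\delta\alpha$ up to higher-order terms, where $\delta k=(\delta k^{(1)},\delta k^{(2)})^T$ and $\delta\alpha=(\delta\alpha_1,\delta\alpha_2)^T$; the first-order recovery error $\delta\alpha$ corresponding to a frequency perturbation $\delta k$ is the solution of the linearised relation $\delta k=J\,\delta\alpha$. $\|\cdot\|_2$ is the Euclidean norm, respectively the induced matrix norm. *)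

(* Defs.v *)
From mathcomp Require Import all_boot all_order all_algebra.
From mathcomp Require Import all_classical all_reals all_analysis.

Set Implicit Arguments.
Unset Strict Implicit.
Unset Printing Implicit Defensive.

Import Order.TTheory GRing.Theory Num.Theory.
Import numFieldNormedType.Exports.

Local Open Scope classical_set_scope.
Local Open Scope ring_scope.

Section RadialProblem.
Variables (R : realType) (d l : nat) (R1 R2 : R).

(* [u'] and [u''] are the first two derivatives of [u] on the open interval.
   Since [u] and [u'] are continuous up to the endpoints, [u' R1] and [u' R2]
   are the one-sided derivatives of [u] there. For [2 <= d] the truncated
   subtraction in [l * (l + d - 2)] is the usual one. *)
Definition radial_eigenfunction (a1 a2 lambda : R) (u : R -> R) : Prop :=
  exists u' u'' : R -> R,
  [/\ {within `[R1, R2], continuous u} /\ {within `[R1, R2], continuous u'},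
      forall r, r \in `]R1, R2[ ->
        [/\ is_derive r 1 u (u' r), is_derive r 1 u' (u'' r) &
            u'' r + d.-1%:R / r * u' r
              + (lambda - (l * (l + d - 2))%:R / r ^+ 2) * u r = 0],
      - u' R1 + a1 * u R1 = 0,
      u' R2 + a2 * u R2 = 0 &
      exists2 r, r \in `[R1, R2] & u r != 0].

Definition normalised_eigenfunction (a1 a2 lambda : R) (u : R -> R) : Prop :=
  radial_eigenfunction a1 a2 lambda u /\
  \int[lebesgue_measure]_(r in `[R1, R2]) (`|u r| ^+ 2 * r ^+ d.-1) = 1.

Definition resonances (a1 a2 : R) : set R :=
  [set k | 0 < k /\ exists u, radial_eigenfunction a1 a2 (k ^+ 2) u].

(* Indices start at 1; the value [k 0] is irrelevant. *)
Definition increasing_enumeration (k : nat -> R) (S : set R) : Prop :=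
  (forall p, (0 < p)%N -> k p < k p.+1) /\
  S = [set k p | p in [set p : nat | (0 < p)%N]].

Definition is_resonance_family (k : nat -> R -> R -> R) : Prop :=
  forall a1 a2, 0 < a1 -> 0 < a2 ->
    increasing_enumeration (fun p => k p a1 a2) (resonances a1 a2).

Definition boundary_mass (r : R) (u : R -> R) : R := r ^+ d.-1 * `|u r| ^+ 2.

End RadialProblem.

Section TwoByTwo.
Variable R : Type.

Definition row2 (x y : R) : 'rV[R]_2 :=
  \row_(j < 2) (if j == ord0 then x else y).

Definition mx2 (x y z t : R) : 'M[R]_2 :=
  \matrix_(i < 2, j < 2)
    (if i == ord0 then (if j == ord0 then x else y)
     else (if j == ord0 then z else t)).

End TwoByTwo.

Definition two_frequency_map (R : realType) (k : nat -> R -> R -> R)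
    (p q : nat) (a : 'rV[R]_2) : 'rV[R]_2 :=
  row2 (k p (a ord0 ord0) (a ord0 ord_max)) (k q (a ord0 ord0) (a ord0 ord_max)).

(* The library norm on matrices is the maximum of the absolute values of the
   entries, so the Euclidean norm and its operator norm are introduced here. *)
Definition norm2 (R : realType) (n : nat) (x : 'cV[R]_n) : R :=
  Num.sqrt (\sum_(i < n) x i ord0 ^+ 2).

Definition opnorm2 (R : realType) (m n : nat) (A : 'M[R]_(m, n)) : R :=
  sup [set norm2 (A *m x) | x in [set x : 'cV[R]_n | norm2 x <= 1]].

(* ['J f] acts on row vectors from the right, so the transpose is the matrix
   whose (j, i) entry is the derivative of the j-th component of [f] with
   respect to the i-th variable. *)
Definition Jacobian_matrix (R : realType) (m n : nat)
    (f : 'rV[R]_n.+1 -> 'rV[R]_m.+1) (a : 'rV[R]_n.+1) : 'M[R]_(m.+1, n.+1) :=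
  (jacobian f a)^T.

Definition C1_on (R : realType) (m n : nat)
    (f : 'rV[R]_n.+1 -> 'rV[R]_m.+1) (U : set 'rV[R]_n.+1) : Prop :=
  forall x, U x ->
    differentiable f x /\ {for x, continuous (Jacobian_matrix f)}.

(* Local invertibility in the sense of the inverse function theorem: the
   local inverse has to be C^1 as well. A local inverse that is merely
   continuous may exist where the Jacobian is singular, as for x |-> x ^ 3. *)
Definition locally_invertible (R : realType) (n : nat)
    (f : 'rV[R]_n.+1 -> 'rV[R]_n.+1) (a : 'rV[R]_n.+1) : Prop :=
  exists (U : set 'rV[R]_n.+1) (g : 'rV[R]_n.+1 -> 'rV[R]_n.+1),
  [/\ open U, U a & open (f @` U)] /\
  [/\ forall x, U x -> g (f x) = x, C1_on f U & C1_on g (f @` U)].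

(* Main.v *)
(** With P = r^(d-1) and v = P u', the radial equation is the linear system
    u' = v / P, v' = (Q - lambda P) u. Picard iteration gives the solution with
    u(R1) = 1, v(R1) = alpha_1 P(R1), and Gronwall's inequality its continuity
    in (lambda, alpha_1). The resonances k are the positive zeros of
    v(R2) + alpha_2 P(R2) u(R2) at lambda = k^2.

    Everything else comes from the Wronskian identity: for eigenfunctions u, u~
    of the problems with data (lambda, alpha), (lambda~, alpha~), equal to 1 at
    R1,
      (lambda - lambda~) int P u u~ =
        (alpha_1 - alpha~_1) P(R1)
        + (alpha_2 - alpha~_2) P(R2) u(R2) u~(R2).
    Applied with one and the same alpha, it shows that nearby zeros coincide and
    that the characteristic function changes sign at each of them. Hence zeros
    neither merge nor disappear as alpha varies, and a compactness argument
    excludes new ones below a given one; so the p-th resonance is continuous in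
    alpha. Applied with two values of alpha, the identity then expresses
    k_p(alpha) - k_p(alpha~) as a linear form in alpha - alpha~ whose coefficients
    are continuous in (alpha, alpha~) and equal b_i / (2 k) on the diagonal.
    Such a two-point difference quotient gives C^1 regularity at once and, when
    its matrix is invertible, the inverse function theorem by a contraction
    estimate. *)

Require Import Defs.
From mathcomp Require Import all_boot all_order all_algebra.
From mathcomp Require Import all_classical all_reals all_analysis.
From mathcomp Require Import ring lra.

Import Order.TTheory GRing.Theory Num.Theory.
Import numFieldNormedType.Exports.

Local Open Scope classical_set_scope.
Local Open Scope ring_scope.

Set Implicit Arguments.
Unset Strict Implicit.
Unset Printing Implicit Defensive.

(** * Differential inequalities *)

Section Calculus.
Variable R : realType.
Implicit Types (f g : R -> R) (a b x : R) (A : set R).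

Lemma is_derive_addf f g x df dg : is_derive x 1 f df -> is_derive x 1 g dg ->
  is_derive x 1 (fun r => f r + g r) (df + dg).
Proof. by move=> ? ?; exact: is_deriveD. Qed.

Lemma is_derive_subf f g x df dg : is_derive x 1 f df -> is_derive x 1 g dg ->
  is_derive x 1 (fun r => f r - g r) (df - dg).
Proof. by move=> ? ?; exact: is_deriveB. Qed.

Lemma is_derive_mulf f g x df dg : is_derive x 1 f df -> is_derive x 1 g dg ->
  is_derive x 1 (fun r => f r * g r) (df * g x + f x * dg).
Proof.
move=> hf hg; apply: (is_derive_eq (is_deriveM hf hg)).
by rewrite addrC [g x *: df]mulrC.
Qed.

Lemma is_derive_cstf (c x : R) : is_derive x 1 (fun=> c) 0.
Proof. exact: is_derive_cst. Qed.

Lemma is_derive_idf x : is_derive x 1 (fun r : R => r) 1.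
Proof. exact: is_derive_id. Qed.

Lemma is_derive_cmulf (c : R) f x df : is_derive x 1 f df ->
  is_derive x 1 (fun r => c * f r) (c * df).
Proof.
by move=> hf; apply: is_derive_eq (is_derive_mulf (is_derive_cstf c x) hf) _; rewrite mul0r add0r.
Qed.

Lemma within_add A f g : {within A, continuous f} -> {within A, continuous g} ->
  {within A, continuous (fun r => f r + g r)}.
Proof. by move=> hf hg x; apply: cvgD; [exact: hf|exact: hg]. Qed.

Lemma within_sub A f g : {within A, continuous f} -> {within A, continuous g} ->
  {within A, continuous (fun r => f r - g r)}.
Proof. by move=> hf hg x; apply: cvgB; [exact: hf|exact: hg]. Qed.

Lemma within_mul A f g : {within A, continuous f} -> {within A, continuous g} ->
  {within A, continuous (fun r => f r * g r)}.
Proof. by move=> hf hg x; apply: cvgM; [exact: hf|exact: hg]. Qed.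

Lemma within_cmul A (c : R) f : {within A, continuous f} ->
  {within A, continuous (fun r => c * f r)}.
Proof. by move=> hf x; apply: cvgM; [exact: cvg_cst|exact: hf]. Qed.

Lemma nondecreasing_of_derive f df a b :
  (forall r, r \in `]a, b[ -> is_derive r 1 f (df r)) ->
  (forall r, r \in `]a, b[ -> 0 <= df r) ->
  {within `[a, b], continuous f} ->
  forall r, r \in `[a, b] -> f a <= f r.
Proof.
move=> hd h0 hc r rab.
have ab : a <= b by move: rab; rewrite in_itv/= => /andP[]; exact: le_trans.
apply: (@ger0_derive1_le_cc _ f a b) => //.
- by move=> z /hd H; exact: ex_derive.
- by move=> z zab; have H := hd _ zab; rewrite derive1E derive_val h0.
- by rewrite in_itv/= lexx.
- by move: rab; rewrite in_itv/= => /andP[].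
Qed.

Lemma le_of_derive_le f g df dg a b :
  (forall r, r \in `]a, b[ -> is_derive r 1 f (df r)) ->
  (forall r, r \in `]a, b[ -> is_derive r 1 g (dg r)) ->
  (forall r, r \in `]a, b[ -> df r <= dg r) ->
  {within `[a, b], continuous f} -> {within `[a, b], continuous g} ->
  forall r, r \in `[a, b] -> f r - f a <= g r - g a.
Proof.
move=> hf hg hfg cf cg r rab.
suff: g a - f a <= g r - f r by lra.
apply: (@nondecreasing_of_derive (fun r => g r - f r) (fun r => dg r - df r) a b) => //.
- by move=> z zab; apply: is_derive_subf; [exact: hg|exact: hf].
- by move=> z zab; rewrite subr_ge0 hfg.
- exact: within_sub.
Qed.

(** Apply [le_of_derive_le] to [f] and to [-f]. This takes the place of bounding an integral by the
    integral of the modulus. *)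
Lemma norm_le_of_derive_le f g df dg a b :
  (forall r, r \in `]a, b[ -> is_derive r 1 f (df r)) ->
  (forall r, r \in `]a, b[ -> is_derive r 1 g (dg r)) ->
  (forall r, r \in `]a, b[ -> `|df r| <= dg r) ->
  {within `[a, b], continuous f} -> {within `[a, b], continuous g} ->
  forall r, r \in `[a, b] -> `|f r - f a| <= g r - g a.
Proof.
move=> hf hg hfg cf cg r rab; rewrite ler_norml; apply/andP; split.
  rewrite lerNl.
  have := @le_of_derive_le (fun r => -1 * f r) g (fun r => -1 * df r) dg a b.
  move=> /(_ _ hg _ _ cg _ rab); rewrite !mulN1r opprB opprK addrC; apply.
  - by move=> z zab; apply: is_derive_cmulf; exact: hf.
  - move=> z zab; have := hfg _ zab; rewrite mulN1r; apply: le_trans.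
    by rewrite -normrN ler_norm.
  - exact: within_cmul.
apply: (le_of_derive_le hf hg) => // z zab.
exact: le_trans (ler_norm _) (hfg _ zab).
Qed.

Lemma constant_of_derive0 f a b :
  (forall r, r \in `]a, b[ -> is_derive r 1 f 0) ->
  {within `[a, b], continuous f} ->
  forall r, r \in `[a, b] -> f r = f a.
Proof.
move=> hd cf r rab; apply/eqP; rewrite -subr_eq0 -normr_le0.
have := @norm_le_of_derive_le f (fun=> 0) (fun=> 0) (fun=> 0) a b hd.
rewrite subr0; apply => //.
- by move=> z _; rewrite normr0.
- by apply: continuous_subspaceT => z; exact: cvg_cst.
Qed.

Lemma is_derive_expR_affine (K a x : R) :
  is_derive x 1 (fun r => expR (K * (r - a))) (K * expR (K * (x - a))).
Proof.
have h : is_derive x 1 (fun r => K * (r - a)) K.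
  apply: (is_derive_eq (is_derive_cmulf K (is_derive_subf (is_derive_idf x) (is_derive_cstf a x)))).
  by rewrite subr0 mulr1.
by rewrite mulrC; apply: (is_derive1_comp (f := expR)).
Qed.

Lemma continuous_expR_affine (K a : R) : continuous (fun r : R => expR (K * (r - a))).
Proof.
move=> x; have ? := is_derive_expR_affine K a x.
by apply: differentiable_continuous; apply/derivable1_diffP; exact: ex_derive.
Qed.

(** The integrating factor exp(-K (r - a)) cancels the term [K * E r]; what remains of the
    derivative of the product is at most C, because the factor is at most 1 on the interval. *)
Lemma gronwall (E dE : R -> R) a b (K C : R) : 0 <= K -> 0 <= C ->
  (forall r, r \in `]a, b[ -> is_derive r 1 E (dE r)) ->
  (forall r, r \in `]a, b[ -> dE r <= K * E r + C) ->
  {within `[a, b], continuous E} ->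
  forall r, r \in `[a, b] -> E r <= (E a + C * (r - a)) * expR (K * (r - a)).
Proof.
move=> K0 C0 hd hle cE r rab.
pose e (r : R) := expR (- K * (r - a)).
have he (z : R) : is_derive z 1 e (- K * e z) by exact: is_derive_expR_affine.
have ce : {within `[a, b], continuous e}.
  by apply: continuous_subspaceT; exact: continuous_expR_affine.
have H : E r * e r - E a * e a <= C * r - C * a.
  apply: (@le_of_derive_le (fun r => E r * e r) (fun r => C * r)
    (fun r => dE r * e r + E r * (- K * e r)) (fun=> C * 1) a b) => //.
  - by move=> z zab; apply: is_derive_mulf => //; exact: hd.
    - move=> z zab; have az : 0 <= z - a.
      by move: zab; rewrite in_itv/= subr_ge0 => /andP[/ltW].
    have e1 : e z <= 1 by rewrite /e -(expR0 R) ler_expR mulNr oppr_le0 mulr_ge0.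
    have e0 : 0 <= e z by exact: expR_ge0.
    have h1 : dE z * e z <= (K * E z + C) * e z by rewrite ler_wpM2r// hle.
    have h2 : C * e z <= C by rewrite ler_piMr.
    lra.
  - exact: within_mul.
  - by apply: within_cmul; apply: continuous_subspaceT => z; exact: cvg_id.
have ea : e a = 1 by rewrite /e subrr mulr0 expR0.
have er : e r * expR (K * (r - a)) = 1 by rewrite /e -expRD mulNr addNr expR0.
rewrite ea mulr1 in H.
rewrite -[E r]mulr1 -er mulrA ler_wpM2r ?expR_ge0//; lra.
Qed.

End Calculus.

(** * Primitives on a compact interval *)

Section Primitive.
Variables (R : realType) (a b : R).
Hypothesis ab : a < b.

(** Nearest-point projection onto [[a, b]]; composing with it freezes a function outside the
    interval. *)
Definition clamp (r : R) : R := Num.max a (Num.min r b).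

Lemma clamp_itv r : clamp r \in `[a, b].
Proof.
rewrite in_itv/= /clamp le_max lexx/= ge_max (ltW ab)/=.
by rewrite ge_min lexx orbT.
Qed.

Lemma clamp_id r : r \in `[a, b] -> clamp r = r.
Proof.
rewrite in_itv/= /clamp => /andP[ar rb].
by rewrite (min_idPl rb) (max_idPr ar).
Qed.

Lemma clamp_continuous : continuous clamp.
Proof.
apply: max_fun_continuous; first by move=> x; exact: cvg_cst.
by apply: min_fun_continuous => x; [exact: cvg_id|exact: cvg_cst].
Qed.

(** Integration starts at [a - 1], so that [base f] is differentiable at every point of [[a, b]],
    the endpoint [a] included. *)
Let base (f : R -> R) (x : R) : R := \int[lebesgue_measure]_(t in `[a - 1, x]) f t.

Let base_der (f : R -> R) (x : R) : continuous f -> a - 1 < x -> is_derive x 1 (base f) (f x).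
Proof.
move=> cf ax.
have fi : lebesgue_measure.-integrable `[a - 1, x + 1] (EFin \o f).
  apply: (@continuous_compact_integrable R f); first exact: segment_compact.
  exact: continuous_subspaceT.
have xx1 : x < x + 1 by rewrite ltrDl.
have [d <-] := continuous_FTC1_closed xx1 fi ax (cf x).
by rewrite derive1E; apply: DeriveDef.
Qed.

Definition primitive (f : R -> R) (r : R) : R := base f (clamp r) - base f a.

Lemma primitive_left f : primitive f a = 0.
Proof. by rewrite /primitive clamp_id ?subrr// in_itv/= lexx ltW. Qed.

Lemma primitive_continuous (f : R -> R) : continuous f -> continuous (primitive f).
Proof.
move=> cf r; apply: cvgB; last exact: cvg_cst.
apply: (@continuous_comp _ _ _ clamp (base f)); first exact: clamp_continuous.
apply: differentiable_continuous; apply/derivable1_diffP.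
have ac : a - 1 < clamp r.
  have := clamp_itv r; rewrite in_itv/= => /andP[+ _].
  by apply: lt_le_trans; rewrite gtrDl ltrN10.
have := base_der cf ac => h; exact: ex_derive.
Qed.

Lemma primitive_derive (f : R -> R) (r : R) : continuous f -> r \in `]a, b[ ->
  is_derive r 1 (primitive f) (f r).
Proof.
move=> cf rab; have ar : a - 1 < r.
  move: rab; rewrite in_itv/= => /andP[+ _].
  by apply: lt_trans; rewrite gtrDl ltrN10.
apply: (@near_eq_is_derive _ _ _ (fun z => base f z - base f a)).
  have := near_in_itvoo rab; apply: filterS => z zab.
  rewrite /primitive clamp_id//; move: zab; rewrite !in_itv/= => /andP[h1 h2].
  by rewrite (ltW h1) (ltW h2).
apply: is_derive_eq (is_derive_subf (base_der cf ar) (is_derive_cstf _ _)) _.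
by rewrite subr0.
Qed.

Lemma norm_primitive_le (f g dg : R -> R) : continuous f ->
  (forall r, r \in `]a, b[ -> is_derive r 1 g (dg r)) ->
  {within `[a, b], continuous g} ->
  (forall r, r \in `]a, b[ -> `|f r| <= dg r) ->
  forall r, r \in `[a, b] -> `|primitive f r| <= g r - g a.
Proof.
move=> cf hg cg hfg r rab.
have := @norm_le_of_derive_le _ (primitive f) g f dg a b _ hg hfg _ cg r rab.
rewrite primitive_left subr0; apply.
- by move=> z zab; exact: primitive_derive.
- by apply: continuous_subspaceT; exact: primitive_continuous.
Qed.

(** Both sides vanish at [a] and have the same derivative in the interior. *)
Lemma primitiveB (f g : R -> R) (r : R) : continuous f -> continuous g -> r \in `[a, b] ->
  primitive f r - primitive g r = primitive (fun z => f z - g z) r.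
Proof.
move=> cf cg rab; apply/eqP; rewrite -subr_eq0; apply/eqP.
have cfg : continuous (fun z => f z - g z) by move=> z; apply: cvgB; [exact: cf|exact: cg].
have := @constant_of_derive0 _ (fun r => primitive f r - primitive g r
  - primitive (fun z => f z - g z) r) a b.
rewrite !primitive_left !subr0; apply => //.
- move=> z zab; apply: is_derive_eq.
    by apply: is_derive_subf; [apply: is_derive_subf|]; apply: primitive_derive.
  by rewrite subrr.
- apply: continuous_subspaceT => z.
  by apply: cvgB; [apply: cvgB|]; exact: primitive_continuous.
Qed.

End Primitive.

Lemma uniform_limit_continuousR (R : realType) (u_ : nat -> R -> R) (l : R -> R) (e_ : nat -> R) :
  (forall n, continuous (u_ n)) -> (forall n r, `|u_ n r - l r| <= e_ n) ->
  e_ n @[n --> \oo] --> (0 : R) -> continuous l.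
Proof.
move=> cu ul e0 x; apply/cvgrPdist_le => e egt0.
have e3 : 0 < e / 3 by rewrite divr_gt0.
have [N _ /(_ N (leqnn N)) /= hN] := (cvgrPdist_le _ _).1 e0 _ e3.
rewrite sub0r normrN in hN.
have hx := (cvgrPdist_le _ _).1 (cu N x) _ e3.
near=> y.
have hy : `|u_ N x - u_ N y| <= e / 3 by near: y; exact: hx.
have h1 := ul N x; have h2 := ul N y.
have h3 := ler_norm (e_ N).
have -> : l x - l y = (u_ N x - u_ N y) - (u_ N x - l x) + (u_ N y - l y) by ring.
have := ler_normD ((u_ N x - u_ N y) - (u_ N x - l x)) (u_ N y - l y).
have := ler_normB (u_ N x - u_ N y) (u_ N x - l x).
lra.
Unshelve. all: by end_near. Qed.

(** * The linear system: existence and dependence on the data *)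

Section LinearSystem.
Variables (R : realType) (a b M : R) (P Q : R -> R).
Hypotheses (ab : a < b) (cP : continuous P) (cQ : continuous Q).
Hypotheses (P0 : forall r, 0 < P r) (PM : forall r, P r <= M)
  (PVM : forall r, (P r)^-1 <= M) (QM : forall r, `|Q r| <= M).

Definition radial_system (lam : R) (u v : R -> R) : Prop :=
  [/\ {within `[a, b], continuous u}, {within `[a, b], continuous v},
      forall r, r \in `]a, b[ -> is_derive r 1 u (v r / P r) &
      forall r, r \in `]a, b[ -> is_derive r 1 v ((Q r - lam * P r) * u r)].

Let M0 : 0 < M. Proof. exact: lt_le_trans (P0 0) (PM 0). Qed.

Let cPV : continuous (fun r => (P r)^-1).
Proof. by move=> r; apply: cvgV; [rewrite gt_eqF|exact: cP]. Qed.

Lemma potential_continuous lam : continuous (fun r => Q r - lam * P r).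
Proof.
move=> r; apply: cvgB; first exact: cQ.
by apply: cvgM; [exact: cvg_cst|exact: cP].
Qed.

Lemma potential_bound (lam r : R) : `|Q r - lam * P r| <= M + `|lam| * M.
Proof.
apply: le_trans (ler_normB _ _) _; apply: lerD => //.
by rewrite normrM ler_wpM2l// ger0_norm// ltW.
Qed.

Section Picard.
Variables (lam s : R).

Let g r := Q r - lam * P r.
Let G := M + `|lam| * M.
(** Integration against the weight exp(K (r - a)) gains a factor 1/K. A Picard step consists of two
    integrations, with coefficients at most G and M, and this K makes M G / K^2 at most 1/2. *)
Let K := 1 + 2 * M * G.

Let G0 : 0 < G. Proof. by rewrite ltr_pwDl// mulr_ge0// ltW. Qed.
Let K0 : 0 < K. Proof. by rewrite addr_gt0// !mulr_gt0. Qed.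

Let cgf (f : R -> R) : continuous f -> continuous (fun z => g z * f z).
Proof. by move=> cf r; apply: cvgM; [exact: potential_continuous|exact: cf]. Qed.

(** The integral equations for the data u(a) = 1, v(a) = s. The second component is computed from
    [f] and inserted into the equation for the first, so that the iteration acts on [u] alone. *)
Definition picard_v (f : R -> R) (r : R) : R :=
  s + primitive a b (fun z => g z * f z) r.

Definition picard_u (f : R -> R) (r : R) : R :=
  1 + primitive a b (fun z => picard_v f z / P z) r.

Let cv (f : R -> R) : continuous f -> continuous (picard_v f).
Proof.
move=> cf r; apply: cvgD; first exact: cvg_cst.
by apply: primitive_continuous => //; exact: cgf.
Qed.

Let cvP (f : R -> R) : continuous f -> continuous (fun z => picard_v f z / P z).
Proof. by move=> cf r; apply: cvgM; [exact: cv|exact: cPV]. Qed.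

Let cu (f : R -> R) : continuous f -> continuous (picard_u f).
Proof.
move=> cf r; apply: cvgD; first exact: cvg_cst.
by apply: primitive_continuous => //; exact: cvP.
Qed.

Let w (r : R) := expR (K * (r - a)).

Let dw (c r : R) : is_derive r 1 (fun z => c / K * w z) (c * w r).
Proof.
apply: (is_derive_eq (is_derive_cmulf (c / K) (is_derive_expR_affine K a r))).
by rewrite mulrA divfK// gt_eqF.
Qed.

Let cw (c : R) : {within `[a, b], continuous (fun z => c / K * w z)}.
Proof.
by apply: within_cmul; apply: continuous_subspaceT; exact: continuous_expR_affine.
Qed.

Let wa : w a = 1. Proof. by rewrite /w subrr mulr0 expR0. Qed.
Let w0 r : 0 <= w r. Proof. exact: expR_ge0. Qed.

(* The weight [expR (K * (r - a))] makes the Picard operator a contraction of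
   ratio 1/2 on the whole interval. *)
Lemma picard_contraction (f h : R -> R) (e : R) : continuous f -> continuous h ->
  0 <= e -> (forall r, r \in `[a, b] -> `|f r - h r| <= e * w r) ->
  forall r, r \in `[a, b] -> `|picard_u f r - picard_u h r| <= e / 2 * w r.
Proof.
move=> cf ch e0 fh.
have oc r : r \in `]a, b[ -> r \in `[a, b].
  by rewrite !in_itv/= => /andP[h1 h2]; rewrite !ltW.
have hv r : r \in `[a, b] -> `|picard_v f r - picard_v h r| <= G * e / K * w r.
  move=> rab.
  have -> : picard_v f r - picard_v h r =
      primitive a b (fun z => g z * f z) r - primitive a b (fun z => g z * h z) r.
    by rewrite /picard_v; ring.
  rewrite (primitiveB ab (cgf cf) (cgf ch) rab).
  have cd : continuous (fun z => g z * f z - g z * h z).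
    by move=> z; apply: cvgB; exact: cgf.
  have H := norm_primitive_le ab cd (g := fun z => G * e / K * w z)
    (dg := fun r => G * e * w r) (fun r _ => dw (G * e) r) (@cw (G * e)).
  apply: le_trans (H _ r rab) _; last first.
    by rewrite wa mulr1 gerBl divr_ge0// ?mulr_ge0// ltW.
  move=> z zab; rewrite -mulrBr normrM -mulrA ler_pM//; last exact/fh/oc.
  exact: potential_bound.
move=> r rab.
have -> : picard_u f r - picard_u h r =
    primitive a b (fun z => picard_v f z / P z) r
    - primitive a b (fun z => picard_v h z / P z) r.
  by rewrite /picard_u; ring.
rewrite (primitiveB ab (cvP cf) (cvP ch) rab).
have cd : continuous (fun z => picard_v f z / P z - picard_v h z / P z).
  by move=> z; apply: cvgB; exact: cvP.
pose c := M * (G * e / K).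
have c0 : 0 <= c by rewrite !mulr_ge0// ?invr_ge0// ltW.
have H := norm_primitive_le ab cd (g := fun z => c / K * w z)
  (dg := fun r => c * w r) (fun r _ => dw c r) (@cw c).
apply: le_trans (H _ r rab) _.
  move=> z zab; rewrite -mulrBl normrM mulrC /c -mulrA ler_pM//; last exact/hv/oc.
  by rewrite ger0_norm// invr_ge0 ltW.
rewrite wa mulr1; apply: (@le_trans _ _ (c / K * w r)).
  by rewrite gerBl divr_ge0// ltW.
rewrite ler_wpM2r//.
have -> : c / K = e * (M * G / (K * K)) by rewrite /c; field; rewrite gt_eqF.
rewrite ler_wpM2l//.
rewrite ler_pdivrMr ?mulr_gt0//.
have MG : 0 < M * G by rewrite mulr_gt0.
have -> : K * K = 1 + 4 * (M * G) + 4 * (M * G) ^+ 2 by rewrite /K; ring.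
have := sqr_ge0 (M * G); lra.
Qed.

Let it n := iter n picard_u (fun=> 0).

Let cit n : continuous (it n).
Proof. by elim: n => [|n IH]; [move=> x; exact: cvg_cst|exact: cu]. Qed.

(** The first increment is bounded by its maximum, since the weight is at least 1; each later step
    halves the bound. *)
Let it_step : exists2 B : R, 0 <= B & forall n r, r \in `[a, b] ->
  `|it n.+1 r - it n r| <= B / 2 ^+ n * w r.
Proof.
have [|c cab hc] := @EVT_max R (fun r => `|it 1 r - it 0 r|) a b (ltW ab).
  apply: continuous_subspaceT => z; apply: cvg_norm.
  by apply: cvgB; exact: cit.
exists `|it 1 c - it 0 c|; first by [].
elim=> [|n IH] r rab.
  rewrite expr0 divr1; apply: le_trans (hc _ rab) _.
  rewrite ler_peMr// -(expR0 R) ler_expR mulr_ge0 ?(ltW K0)//.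
  by move: rab; rewrite in_itv/= subr_ge0 => /andP[].
rewrite exprSr invfM mulrA.
apply: (@picard_contraction (it n.+1) (it n) (`|it 1 c - it 0 c| / 2 ^+ n)) => //; exact: cit.
Qed.

(** The iterates are Cauchy at each point of [[a, b]]. The limit is taken along [clamp], and the
    weight is bounded by its value at [b], so the convergence is uniform and the limit continuous on
    the line. *)
Let it_lim : exists2 l : R -> R, continuous l &
  exists2 B : R, 0 <= B & forall n r, r \in `[a, b] ->
    `|it n r - l r| <= B / 2 ^+ n * w r.
Proof.
have [B B0 hB] := it_step.
(* The remainder of the geometric series is kept, so that the induction on [m] ends in an equality
   of coefficients. *)
have hnm n m r : r \in `[a, b] ->
    `|it (n + m)%N r - it n r| <= (2 * B / 2 ^+ n - 2 * B / 2 ^+ (n + m)%N) * w r.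
  move=> rab; elim: m => [|m IH]; first by rewrite addn0 !subrr normr0 mul0r.
  have -> : it (n + m.+1)%N r - it n r =
      (it (n + m).+1 r - it (n + m)%N r) + (it (n + m)%N r - it n r).
    by rewrite addnS; ring.
  apply: le_trans (ler_normD _ _) _.
  apply: le_trans (lerD (hB _ _ rab) IH) _.
  rewrite -mulrDl ler_wpM2r// addnS exprS.
  rewrite le_eqVlt; apply/orP; left; apply/eqP.
  by field; rewrite !expf_neq0.
have hnm' n m r : r \in `[a, b] -> `|it (n + m)%N r - it n r| <= 2 * B / 2 ^+ n * w r.
  move=> rab; apply: le_trans (hnm _ _ _ rab) _; rewrite ler_wpM2r//.
  by rewrite gerBl divr_ge0// ?mulr_ge0// exprn_ge0.
have e0 (C : R) : (fun n : nat => C / 2 ^+ n) @ \oo --> (0 : R).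
  have := @cvg_geometric R C 2^-1; rewrite ger0_norm ?invr_ge0//.
  have -> : geometric C 2^-1 = (fun n : nat => C / 2 ^+ n :> R).
    by apply/funext => n /=; rewrite exprVn.
  by apply; rewrite invf_lt1// ltr1n.
have cvgit r : r \in `[a, b] -> cvg (it n r @[n --> \oo]).
  move=> rab; apply/cauchy_cvgP; apply: cauchy_exP => e egt0.
  have [N _ /(_ N (leqnn N)) /= hN] := (cvgrPdist_lt _ _).1 (e0 (2 * B * w r)) _ egt0.
  exists (it N r); exists N => //= n /= Nn.
  rewrite -ball_normE/= distrC -(subnKC Nn).
  apply: le_lt_trans (hnm' _ _ _ rab) _.
  apply: le_lt_trans hN; rewrite sub0r normrN.
  by rewrite mulrAC; exact: ler_norm.
have hl n r : r \in `[a, b] -> `|it n r - lim (it m r @[m --> \oo])| <= 2 * B / 2 ^+ n * w r.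
  move=> rab.
  have c1 : `|it n r - it m r| @[m --> \oo] --> `|it n r - lim (it m r @[m --> \oo])|.
    by apply: cvg_norm; apply: cvgB; [exact: cvg_cst|exact: cvgit].
  rewrite -(cvg_lim _ c1)//; apply: limr_le; first by apply/cvg_ex; exists (`|it n r - lim (it m r @[m --> \oo])|).
  by exists n => //= m /= nm; rewrite distrC -(subnKC nm) hnm'.
exists (fun r => lim (it m (clamp a b r) @[m --> \oo])).
  apply: (@uniform_limit_continuousR _ (fun n r => it n (clamp a b r)) _
    (fun n => 2 * B * w b / 2 ^+ n)) => //.
    move=> n x; apply: (@continuous_comp _ _ _ (clamp a b)); last exact: cit.
    exact: clamp_continuous.
  move=> n r; apply: le_trans (hl n _ (clamp_itv ab r)) _.
  rewrite -!mulrA ler_wpM2l// ler_wpM2l// [leRHS]mulrC ler_wpM2l ?invr_ge0 ?exprn_ge0//.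
  rewrite ler_expR ler_wpM2l ?(ltW K0)// lerB//.
  by have := clamp_itv ab r; rewrite in_itv/= => /andP[].
exists (2 * B); first by rewrite mulr_ge0.
by move=> n r rab; rewrite clamp_id//; exact: hl.
Qed.

(** The limit [l] is a fixed point only on [[a, b]]. The solution returned is therefore
    [picard_u l], which agrees with [l] there and is differentiable by construction. *)
Lemma initial_value_problem : exists u v : R -> R,
  [/\ continuous u, continuous v, radial_system lam u v, u a = 1 & v a = s].
Proof.
have [l cl [B B0 hB]] := it_lim.
have fixl r : r \in `[a, b] -> picard_u l r = l r.
  move=> rab; apply/eqP; rewrite -subr_eq0 -normr_le0.
  have h n : `|picard_u l r - l r| <= B * w r / 2 ^+ n.
    have -> : picard_u l r - l r = (it n.+1 r - l r) - (it n.+1 r - picard_u l r) by ring.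
    apply: le_trans (ler_normB _ _) _.
    have h1 := hB n.+1 r rab.
    have h2 : `|it n.+1 r - picard_u l r| <= (B / 2 ^+ n) / 2 * w r.
      have Bn : 0 <= B / 2 ^+ n by rewrite divr_ge0// exprn_ge0.
      exact: (@picard_contraction (it n) l _ (@cit n) cl Bn (hB n) r rab).
    apply: le_trans (lerD h1 h2) _.
    rewrite le_eqVlt exprS; apply/orP; left; apply/eqP.
    by field; rewrite expf_neq0.
  have e0 : (fun n : nat => B * w r / 2 ^+ n) @ \oo --> (0 : R).
    have := @cvg_geometric R (B * w r) 2^-1; rewrite ger0_norm ?invr_ge0//.
    have -> : geometric (B * w r) 2^-1 = (fun n : nat => B * w r / 2 ^+ n :> R).
      by apply/funext => n /=; rewrite exprVn.
    by apply; rewrite invf_lt1// ltr1n.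
  rewrite -(cvg_lim _ e0)//; apply: limr_ge; first by apply/cvg_ex; exists 0.
  by exists 0%N.
have oc r : r \in `]a, b[ -> r \in `[a, b].
  by rewrite !in_itv/= => /andP[h1 h2]; rewrite !ltW.
exists (picard_u l), (picard_v l); split.
- exact: cu.
- exact: cv.
- split; [by apply: continuous_subspaceT; exact: cu|by apply: continuous_subspaceT; exact: cv| |].
  + move=> r rab; have := is_derive_addf (is_derive_cstf 1 r) (primitive_derive (cvP cl) rab).
    by rewrite add0r.
  + move=> r rab; have := is_derive_addf (is_derive_cstf s r) (primitive_derive (cgf cl) rab).
    by rewrite add0r fixl//; exact: oc.
- by rewrite /picard_u primitive_left// addr0.
- by rewrite /picard_v primitive_left// addr0.
Qed.

End Picard.
End LinearSystem.

(** From D <= (1 + D)^2: the cruder factor 1 + D avoids the square root of D. *)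
Lemma norm_le_of_sqr_le (R : realType) (x t D : R) :
  0 <= t -> 0 <= D -> x ^+ 2 <= D * t ^+ 2 -> `|x| <= (1 + D) * t.
Proof.
move=> t0 D0 h.
have h0 : 0 <= (1 + D) * t by rewrite mulr_ge0// addr_ge0.
rewrite -(ler_pXn2r (n := 2)) ?nnegrE// real_normK ?num_real//.
apply: le_trans h _; rewrite exprMn ler_wpM2r ?sqr_ge0//.
have := sqr_ge0 D; nra.
Qed.

(** * Dependence on the data, uniqueness and the Lagrange identity *)

Section Dependence.
Variables (R : realType) (a b M : R) (P Q : R -> R).
Hypotheses (ab : a < b) (cP : continuous P)
  (P0 : forall r, 0 < P r) (PM : forall r, P r <= M)
  (PVM : forall r, (P r)^-1 <= M) (QM : forall r, `|Q r| <= M).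
Local Notation sol := (radial_system a b P Q).

Let M0 : 0 < M. Proof. exact: lt_le_trans (P0 0) (PM 0). Qed.
Let oc (r : R) : r \in `]a, b[ -> r \in `[a, b].
Proof. by rewrite !in_itv/= => /andP[h1 h2]; rewrite !ltW. Qed.
Let inb : b \in `[a, b]. Proof. by rewrite in_itv/= lexx ltW. Qed.

Lemma radial_system_scale (c lam : R) (u v : R -> R) : sol lam u v ->
  sol lam (fun r => c * u r) (fun r => c * v r).
Proof.
move=> [cu cv du dv]; split; [exact: within_cmul|exact: within_cmul| |].
- move=> r rab; rewrite -mulrA; exact: is_derive_cmulf (du _ rab).
- move=> r rab; rewrite mulrCA; exact: is_derive_cmulf (dv _ rab).
Qed.

(** Gronwall's inequality for the squared distance of the two solutions. Their difference solves the
    system for [lam] up to the forcing term (mu - lam) P u', so that a bound on the second solution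
    suffices. *)
Lemma radial_system_diff_le (lam mu B : R) (u v u' v' : R -> R) :
  sol lam u v -> sol mu u' v' ->
  (forall r, r \in `[a, b] -> `|u' r| <= B) ->
  forall r, r \in `[a, b] ->
  (u r - u' r) ^+ 2 + (v r - v' r) ^+ 2 <=
    ((u a - u' a) ^+ 2 + (v a - v' a) ^+ 2 + ((lam - mu) * M * B) ^+ 2 * (r - a))
    * expR ((2 * M + `|lam| * M + 1) * (r - a)).
Proof.
move=> [cu cv du dv] [cu' cv' du' dv'] hB r rab.
set K := 2 * M + `|lam| * M + 1.
pose x z := u z - u' z; pose y z := v z - v' z.
pose dE z := 2 * x z * (y z / P z) + 2 * y z *
   ((Q z - lam * P z) * u z - (Q z - mu * P z) * u' z).
have := @gronwall _ (fun z => x z ^+ 2 + y z ^+ 2) dE a b K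
  (((lam - mu) * M * B) ^+ 2) _ _ _ _ _ r rab.
apply.
- by rewrite /K !addr_ge0// mulr_ge0// ltW.
- exact: sqr_ge0.
- move=> z zab.
  have dx := is_derive_subf (du _ zab) (du' _ zab).
  have dy := is_derive_subf (dv _ zab) (dv' _ zab).
  have := is_derive_addf (is_derive_mulf dx dx) (is_derive_mulf dy dy).
  have -> : (fun r0 => (u r0 - u' r0) * (u r0 - u' r0) + (v r0 - v' r0) * (v r0 - v' r0))
    = (fun z => x z ^+ 2 + y z ^+ 2) by apply/funext => t; rewrite !expr2.
  move=> h; apply: (is_derive_eq h); rewrite /dE /x /y; ring.
- move=> z zab.
  (* The terms quadratic in the difference form a multiple of 2 x y, at most |c| (x^2 + y^2); the
     forcing is absorbed by -2 y d <= y^2 + d^2. *)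
  set c := (P z)^-1 + Q z - lam * P z.
  set d := (lam - mu) * P z * u' z.
  have -> : dE z = c * (2 * x z * y z) - 2 * y z * d.
    by rewrite /dE /x /y /c /d; ring.
  have hc : `|c| <= 2 * M + `|lam| * M.
    rewrite /c; apply: le_trans (ler_normB _ _) _.
    have h1 : `|(P z)^-1 + Q z| <= M + M.
      apply: le_trans (ler_normD _ _) _; apply: lerD => //.
      by rewrite ger0_norm// invr_ge0 ltW.
    have h2 : `|lam * P z| <= `|lam| * M.
      by rewrite normrM ler_wpM2l// ger0_norm// ltW.
    lra.
  have h1 : c * (2 * x z * y z) <= (2 * M + `|lam| * M) * (x z ^+ 2 + y z ^+ 2).
    apply: le_trans (ler_norm _) _; rewrite normrM ler_pM//.
    rewrite ler_norml; apply/andP; split.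
      have := sqr_ge0 (x z + y z); lra.
    have := sqr_ge0 (x z - y z); lra.
  have hd : d ^+ 2 <= ((lam - mu) * M * B) ^+ 2.
    rewrite -[d ^+ 2]real_normK ?num_real// -[leRHS]real_normK ?num_real//.
    rewrite ler_pXn2r ?nnegrE// !normrM ler_pM ?mulr_ge0//.
      by rewrite ler_wpM2l// !ger0_norm// ltW.
    by apply: le_trans (hB _ (oc zab)) _; exact: ler_norm.
  have := sqr_ge0 (y z + d); have := sqr_ge0 (x z); rewrite /K; lra.
- apply: within_add; rewrite /x /y.
    have -> : (fun r0 => (u r0 - u' r0) ^+ 2) = (fun r0 => (u r0 - u' r0) * (u r0 - u' r0)).
      by apply/funext => t; rewrite expr2.
    by apply: within_mul; exact: within_sub.
  have -> : (fun r0 => (v r0 - v' r0) ^+ 2) = (fun r0 => (v r0 - v' r0) * (v r0 - v' r0)).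
    by apply/funext => t; rewrite expr2.
  by apply: within_mul; exact: within_sub.
Qed.

Lemma within_bounded (f : R -> R) : {within `[a, b], continuous f} ->
  exists2 B : R, 0 <= B & forall r, r \in `[a, b] -> `|f r| <= B.
Proof.
move=> cf.
have [|c cab hc] := @EVT_max R (fun r => `|f r|) a b (ltW ab).
  by move=> z; apply: cvg_norm; exact: cf.
by exists `|f c|.
Qed.

Lemma radial_system_unique (lam : R) (u v u' v' : R -> R) :
  sol lam u v -> sol lam u' v' -> u a = u' a -> v a = v' a ->
  forall r, r \in `[a, b] -> u r = u' r /\ v r = v' r.
Proof.
move=> h h' ua va r rab; have [B B0 hB] : exists2 B : R, 0 <= B &
  forall r, r \in `[a, b] -> `|u' r| <= B by apply: within_bounded; case: h'.
have := radial_system_diff_le h h' hB rab.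
rewrite ua va !subrr !mul0r expr0n/= mul0r !addr0 mul0r => h0.
have hx : (u r - u' r) ^+ 2 = 0.
  apply/eqP; rewrite eq_le sqr_ge0 andbT; have := sqr_ge0 (v r - v' r); lra.
have hy : (v r - v' r) ^+ 2 = 0.
  apply/eqP; rewrite eq_le sqr_ge0 andbT; have := sqr_ge0 (u r - u' r); lra.
move/eqP: hx; move/eqP: hy; rewrite !sqrf_eq0 !subr_eq0.
by move=> /eqP -> /eqP ->.
Qed.

(* The derivative of [v u' - u v'] is [- (lam - mu) P u u']. *)
Lemma lagrange_identity (lam mu : R) (u v u' v' : R -> R) :
  continuous u -> continuous u' -> sol lam u v -> sol mu u' v' ->
  v b * u' b - u b * v' b =
    v a * u' a - u a * v' a
    - (lam - mu) * primitive a b (fun r => P r * (u r * u' r)) b.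
Proof.
move=> Cu Cu' [cu cv du dv] [cu' cv' du' dv'].
have cf : continuous (fun r => P r * (u r * u' r)).
  by move=> z; apply: cvgM; [exact: cP|apply: cvgM; [exact: Cu|exact: Cu']].
have cp : {within `[a, b], continuous (primitive a b (fun r => P r * (u r * u' r)))}.
  by apply: continuous_subspaceT; exact: primitive_continuous.
pose w z := v z * u' z - u z * v' z.
have := @constant_of_derive0 _ (fun z => w z + (lam - mu) *
  primitive a b (fun r => P r * (u r * u' r)) z) a b _ _ b inb.
rewrite primitive_left// mulr0 addr0 /w => h.
apply/eqP; rewrite eq_sym subr_eq eq_sym; apply/eqP; apply: h.
- move=> z zab.
  have d1 := is_derive_mulf (dv _ zab) (du' _ zab).
  have d2 := is_derive_mulf (du _ zab) (dv' _ zab).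
  have d3 := is_derive_cmulf (lam - mu) (primitive_derive cf zab).
  apply: (is_derive_eq (is_derive_addf (is_derive_subf d1 d2) d3)).
  by have /lt0r_neq0 Pz := P0 z; field.
- by apply: within_add; [apply: within_sub; exact: within_mul|exact: within_cmul].
Qed.

End Dependence.

(** * The solutions with value 1 at [a], indexed by the pair [t] of spectral parameter and v(a) *)

Section Family.
Variables (R : realType) (a b M : R) (P Q : R -> R).
Hypotheses (ab : a < b) (cP : continuous P)
  (P0 : forall r, 0 < P r) (PM : forall r, P r <= M)
  (PVM : forall r, (P r)^-1 <= M) (QM : forall r, `|Q r| <= M)
  (Q0 : forall r, 0 <= Q r).
Local Notation sol := (radial_system a b P Q).

Variables (U V : R * R -> R -> R).
Hypotheses (cU : forall t, continuous (U t))
  (UV : forall t, sol t.1 (U t) (V t))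
  (Ua : forall t, U t a = 1) (Va : forall t, V t a = t.2).

Let M0 : 0 < M. Proof. exact: lt_le_trans (P0 0) (PM 0). Qed.
Let oc (r : R) : r \in `]a, b[ -> r \in `[a, b].
Proof. by rewrite !in_itv/= => /andP[h1 h2]; rewrite !ltW. Qed.
Let inb : b \in `[a, b]. Proof. by rewrite in_itv/= lexx ltW. Qed.

(** The constant in [radial_system_diff_le] is bounded for [t] near [t0], which gives continuity in
    [t] uniformly in [r]. *)
Lemma family_near (t0 : R * R) (e : R) : 0 < e ->
  \forall t \near t0, forall r, r \in `[a, b] ->
    `|U t r - U t0 r| <= e /\ `|V t r - V t0 r| <= e.
Proof.
move=> e0.
have [B B0 hB] : exists2 B : R, 0 <= B & forall r, r \in `[a, b] -> `|U t0 r| <= B.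
  by apply: (within_bounded ab); apply: continuous_subspaceT; exact: cU.
pose N := 2 * M + (`|t0.1| + 1) * M + 1.
pose D := (1 + (M * B) ^+ 2 * (b - a)) * expR (N * (b - a)).
have ba : 0 < b - a by rewrite subr_gt0.
have D0 : 0 <= D.
  by rewrite mulr_ge0 ?expR_ge0// addr_ge0// mulr_ge0 ?sqr_ge0// ltW.
(* The bound 1 keeps |t.1| below |t0.1| + 1, the value built into [N]; the factor 2 counts the two
   coordinates of t - t0. *)
pose del := Num.min 1 (e / (2 * (1 + D))).
have D1 : 0 < 1 + D by rewrite ltr_pwDl.
have del0 : 0 < del by rewrite lt_min ltr01 divr_gt0// mulr_gt0.
near=> t.
have [h1 h2] : `|t0.1 - t.1| < del /\ `|t0.2 - t.2| < del.
  by near: t; apply/nbhs_ballP; exists del => //= t [].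
have del1 : del <= 1 by rewrite ge_min lexx.
have dele : 2 * del * (1 + D) <= e.
  rewrite mulrAC -ler_pdivlMl ?mulr_gt0// mulrC.
  by rewrite /del ge_min lexx orbT.
have N1 : 2 * M + `|t.1| * M + 1 <= N.
  rewrite /N lerD2r lerD2l ler_wpM2r ?(ltW M0)//.
  have := ler_normB t0.1 (t0.1 - t.1); rewrite opprB addrCA subrr addr0; lra.
move=> r rab.
have ra : 0 <= r - a <= b - a.
  by move: rab; rewrite in_itv/= => /andP[? ?]; rewrite subr_ge0 lerD2r; apply/andP.
have H : (U t r - U t0 r) ^+ 2 + (V t r - V t0 r) ^+ 2 <=
    D * (`|t0.1 - t.1| + `|t0.2 - t.2|) ^+ 2.
  have := radial_system_diff_le P0 PM PVM QM (UV t) (UV t0) hB rab.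
  rewrite !Ua !Va subrr expr0n/= add0r => /le_trans; apply.
  have -> : D * (`|t0.1 - t.1| + `|t0.2 - t.2|) ^+ 2 =
    ((`|t0.1 - t.1| + `|t0.2 - t.2|) ^+ 2 + (M * B) ^+ 2 * (b - a) *
    (`|t0.1 - t.1| + `|t0.2 - t.2|) ^+ 2) * expR (N * (b - a)).
    by rewrite /D; ring.
  have s1 : (t.1 - t0.1) ^+ 2 <= (`|t0.1 - t.1| + `|t0.2 - t.2|) ^+ 2.
    rewrite -[leLHS]real_normK ?num_real// distrC ler_pXn2r ?nnegrE ?addr_ge0//.
    by rewrite lerDl.
  have s2 : (t.2 - t0.2) ^+ 2 <= (`|t0.1 - t.1| + `|t0.2 - t.2|) ^+ 2.
    rewrite -[leLHS]real_normK ?num_real// distrC ler_pXn2r ?nnegrE ?addr_ge0//.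
    by rewrite lerDr.
  case/andP: ra => ra0 rab'.
  apply: ler_pM.
  - by rewrite addr_ge0 ?sqr_ge0// mulr_ge0 ?sqr_ge0.
  - exact: expR_ge0.
  - rewrite lerD//.
    have -> : ((t.1 - t0.1) * M * B) ^+ 2 * (r - a) =
      (M * B) ^+ 2 * (r - a) * (t.1 - t0.1) ^+ 2 by ring.
    have MB : 0 <= (M * B) ^+ 2 by exact: sqr_ge0.
    have t1 : 0 <= (t.1 - t0.1) ^+ 2 by exact: sqr_ge0.
    by rewrite ler_pM//; [exact: mulr_ge0|exact: ler_wpM2l].
  - rewrite ler_expR; apply: ler_pM => //.
    by rewrite !addr_ge0// mulr_ge0// ltW.
have fin x : x ^+ 2 <= D * (`|t0.1 - t.1| + `|t0.2 - t.2|) ^+ 2 -> `|x| <= e.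
  move=> /norm_le_of_sqr_le h; apply: le_trans (h _ D0) _; first by rewrite addr_ge0.
  apply: le_trans dele; rewrite [leRHS]mulrC ler_wpM2l ?(ltW D1)//; lra.
split; apply: fin.
  have := sqr_ge0 (V t r - V t0 r); lra.
have := sqr_ge0 (U t r - U t0 r); lra.
Unshelve. all: by end_near. Qed.

Lemma U_right_continuous : continuous (fun t => U t b).
Proof.
move=> t0; apply/cvgrPdist_le => e e0.
have h := family_near t0 e0; near=> t.
have /(_ b inb)[hu _] : forall r, r \in `[a, b] ->
    `|U t r - U t0 r| <= e /\ `|V t r - V t0 r| <= e by near: t.
by rewrite distrC.
Unshelve. all: by end_near. Qed.

Lemma V_right_continuous : continuous (fun t => V t b).
Proof.
move=> t0; apply/cvgrPdist_le => e e0.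
have h := family_near t0 e0; near=> t.
have /(_ b inb)[_ hu] : forall r, r \in `[a, b] ->
    `|U t r - U t0 r| <= e /\ `|V t r - V t0 r| <= e by near: t.
by rewrite distrC.
Unshelve. all: by end_near. Qed.

Let cf t t' : continuous (fun r => P r * (U t r * U t' r)).
Proof. by move=> z; apply: cvgM; [exact: cP|apply: cvgM; exact: cU]. Qed.

(** The inner product of two solutions in L^2 with weight [P]. *)
Definition inner (t t' : R * R) : R := primitive a b (fun r => P r * (U t r * U t' r)) b.

Lemma inner_continuous : continuous (fun tt : (R * R) * (R * R) => inner tt.1 tt.2).
Proof.
move=> [t0 t0']; apply/cvgrPdist_le => e e0 /=.
have [B B0 hB] : exists2 B : R, 0 <= B & forall r, r \in `[a, b] -> `|U t0 r| <= B.
  by apply: (within_bounded ab); apply: continuous_subspaceT; exact: cU.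
have [B' B'0 hB'] : exists2 B : R, 0 <= B & forall r, r \in `[a, b] -> `|U t0' r| <= B.
  by apply: (within_bounded ab); apply: continuous_subspaceT; exact: cU.
have ba : 0 < b - a by rewrite subr_gt0.
pose C := M * (B + B' + 1) * (b - a).
have C0 : 0 < C by rewrite !mulr_gt0// ltr_wpDl// addr_ge0.
pose d := Num.min 1 (e / C).
have d0 : 0 < d by rewrite lt_min ltr01 divr_gt0.
have d1 : d <= 1 by rewrite ge_min lexx.
have dC : d * C <= e by rewrite -ler_pdivlMr// /d ge_min lexx orbT.
have h := family_near t0 d0; have h' := family_near t0' d0.
exists ([set t | forall r, r \in `[a, b] ->
    `|U t r - U t0 r| <= d /\ `|V t r - V t0 r| <= d],
  [set t | forall r, r \in `[a, b] ->
    `|U t r - U t0' r| <= d /\ `|V t r - V t0' r| <= d]) => //=.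
move=> [t t'] /= [ht ht'].
rewrite /inner distrC (primitiveB ab (@cf t t') (@cf t0 t0') inb).
have cd : continuous (fun r => P r * (U t r * U t' r) - P r * (U t0 r * U t0' r)).
  by move=> z; apply: cvgB; exact: cf.
have H := norm_primitive_le ab cd (g := fun z => (d * (M * (B + B' + 1))) * z)
  (dg := fun=> d * (M * (B + B' + 1)) * 1)
  (fun z _ => is_derive_cmulf _ (is_derive_idf z)).
apply: le_trans (H _ _ b inb) _.
- by apply: continuous_subspaceT => z; apply: cvgM; [exact: cvg_cst|exact: cvg_id].
- move=> z zab; rewrite mulr1.
  have zab' := oc zab.
  have [h1 _] := ht z zab'; have [h2 _] := ht' z zab'.
  (* Since [d <= 1], the product of the two increments is at most [d]; the three terms then add up
     to [d * (B + B' + 1)]. *)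
  have -> : P z * (U t z * U t' z) - P z * (U t0 z * U t0' z) =
    P z * ((U t z - U t0 z) * (U t' z - U t0' z) + (U t z - U t0 z) * U t0' z
     + U t0 z * (U t' z - U t0' z)) by ring.
  rewrite normrM mulrCA ger0_norm; last exact: ltW.
  apply: ler_pM => //; first exact: ltW.
  apply: le_trans (ler_normD _ _) _.
  have k3 : `|U t0 z * (U t' z - U t0' z)| <= B * d.
    by rewrite normrM ler_pM// hB.
  have k2 : `|(U t z - U t0 z) * U t0' z| <= d * B'.
    by rewrite normrM ler_pM// hB'.
  have k1 : `|(U t z - U t0 z) * (U t' z - U t0' z)| <= d * 1.
    by rewrite normrM ler_pM// (le_trans h2).
  have := ler_normD ((U t z - U t0 z) * (U t' z - U t0' z)) ((U t z - U t0 z) * U t0' z).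
  lra.
- by rewrite -mulrBr -!mulrA -/C in dC *; rewrite !mulrA in dC *.
Qed.

(** If the value were 0, the nondecreasing function [Z] would vanish on [[a, b]], hence so would its
    derivative P U^2 in the interior. This contradicts U(a) = 1 by continuity at [a]. *)
Lemma inner_gt0 t : 0 < inner t t.
Proof.
pose Z := primitive a b (fun r => P r * (U t r * U t r)).
have cZ : {within `[a, b], continuous Z}.
  by apply: continuous_subspaceT; exact: primitive_continuous.
have dZ z : z \in `]a, b[ -> is_derive z 1 Z (P z * (U t z * U t z)).
  by move=> zab; exact: primitive_derive.
have dZ0 z : 0 <= P z * (U t z * U t z) by rewrite mulr_ge0 ?(ltW (P0 z))// -expr2 sqr_ge0.
have Za : Z a = 0 by exact: primitive_left.
rewrite lt_neqAle; apply/andP; split; last first.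
  by have := nondecreasing_of_derive dZ (fun y _ => dZ0 y) cZ inb; rewrite Za.
apply/eqP => Zb0; have Zb : Z b = 0 by rewrite [RHS]Zb0.
have Zcst z : z \in `[a, b] -> Z z = 0.
  move=> zab; apply/eqP; rewrite eq_le; apply/andP; split; last first.
    by have := nondecreasing_of_derive dZ (fun y _ => dZ0 y) cZ zab; rewrite Za.
  have dZ' y : y \in `]z, b[ -> is_derive y 1 Z (P y * (U t y * U t y)).
    move=> yzb; apply: dZ; move: yzb zab; rewrite !in_itv/= => /andP[y1 ->] /andP[az _].
    by rewrite (le_lt_trans az).
  have cZ' : {within `[z, b], continuous Z}.
    by apply: continuous_subspaceT; exact: primitive_continuous.
  have bzb : b \in `[z, b] by move: zab; rewrite !in_itv/= lexx => /andP[_ ->].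
  have := nondecreasing_of_derive dZ' (fun y _ => dZ0 y) cZ' bzb.
  by rewrite Zb.
have Uz0 z : z \in `]a, b[ -> U t z = 0.
  move=> zab; have h := dZ z zab.
  have h0 : is_derive z 1 Z 0.
    apply: (near_eq_is_derive _ (is_derive_cstf 0 z)).
    by have := near_in_itvoo zab; apply: filterS => y /oc /Zcst ->.
  have := @derive_val _ _ _ _ _ _ _ h; rewrite (@derive_val _ _ _ _ _ _ _ h0).
  move=> /esym/eqP; rewrite mulf_eq0 gt_eqF//= mulf_eq0 orbb.
  by move=> /eqP.
have hc : \forall z \near a, `|U t a - U t z| < 1.
  exact: ((cvgrPdist_lt _ _).1 (@cU t a) 1 ltr01).
have [z zab hz] : exists2 z, z \in `]a, b[ & `|U t a - U t z| < 1.
  have [d /= d0 hd] := (nbhs_ballP _ _).1 hc.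
  have m0 : 0 < Num.min (d / 2) ((b - a) / 2).
    by rewrite lt_min !divr_gt0// subr_gt0.
  have m1 : Num.min (d / 2) ((b - a) / 2) <= (b - a) / 2 by rewrite ge_min lexx orbT.
  have m2 : Num.min (d / 2) ((b - a) / 2) <= d / 2 by rewrite ge_min lexx.
  exists (a + Num.min (d / 2) ((b - a) / 2)).
    by rewrite in_itv/= ltrDl m0/=; lra.
  apply: hd; rewrite /= -ball_normE/= opprD addrA subrr sub0r normrN gtr0_norm//.
  lra.
by move: hz; rewrite Ua Uz0// subr0 normr1 ltxx.
Qed.

(* [c] stands for [alpha_2 * P b] and [t.2] for [alpha_1 * P a]: the zeros are
   the eigenvalues [t.1] of the Robin problem. *)
Definition char_fun (t : R * R) (c : R) : R := V t b + c * U t b.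

(** The Lagrange identity, with v eliminated at both ends in favour of [char_fun] and the initial
    data. It holds for all parameters, whether or not they are eigenvalues. *)
Lemma char_fun_identity t t' c c' :
  char_fun t c * U t' b - U t b * char_fun t' c' - (c - c') * (U t b * U t' b)
  - (t.2 - t'.2) = - (t.1 - t'.1) * inner t t'.
Proof.
have := lagrange_identity ab cP P0 (@cU t) (@cU t') (UV t) (UV t').
rewrite !Ua !Va -/(inner t t') /char_fun => h.
have -> : (V t b + c * U t b) * U t' b - U t b * (V t' b + c' * U t' b)
   - (c - c') * (U t b * U t' b) - (t.2 - t'.2) =
   (V t b * U t' b - U t b * V t' b) - (t.2 - t'.2) by ring.
by rewrite h; ring.
Qed.

(** For lambda = 0 the product u v has derivative v^2 / P + Q u^2 >= 0 and starts at s > 0, whereas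
    a zero of [char_fun] would give u v = -c u^2 <= 0 at [b]. *)
Lemma char_fun0_neq0 (s c : R) : 0 < s -> 0 <= c -> char_fun (0, s) c != 0.
Proof.
move=> s0 c0; apply/eqP; rewrite /char_fun; set t := (0, s) => h.
have [cu cv du dv] := UV t.
have : U t a * V t a <= U t b * V t b.
  apply: (@nondecreasing_of_derive _ (fun r => U t r * V t r)
    (fun r => V t r / P r * V t r + U t r * ((Q r - t.1 * P r) * U t r)) a b) => //.
  - by move=> r rab; apply: is_derive_mulf; [exact: du|exact: dv].
  - move=> r rab; rewrite /t/= mul0r subr0 mulrAC mulrCA -!expr2 addr_ge0//.
      by rewrite divr_ge0 ?sqr_ge0// ltW.
    by rewrite mulr_ge0// sqr_ge0.
  - exact: within_mul.
rewrite Ua Va mul1r /=.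
have -> : V t b = - (c * U t b) by lra.
have : 0 <= c * U t b ^+ 2 by rewrite mulr_ge0// sqr_ge0.
lra.
Qed.

End Family.

(** * Continuity of enumerated zeros *)

Section EnumeratedZeros.
Variables (R : realType) (T : topologicalType) (W : set T) (psi : R -> T -> R)
  (K : nat -> T -> R).
Hypotheses (oW : open W)
  (cpsi : continuous (fun p : R * T => psi p.1 p.2))
  (psi0 : forall x, W x -> psi 0 x != 0)
  (psi_unique : forall x0 (k0 : R), W x0 -> 0 < k0 -> psi k0 x0 = 0 ->
    exists2 d : R, 0 < d & \forall x \near x0, forall k k' : R,
      `|k - k0| < d -> `|k' - k0| < d -> psi k x = 0 -> psi k' x = 0 -> k = k')
  (psi_sign : forall x0 (k0 : R), W x0 -> 0 < k0 -> psi k0 x0 = 0 ->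
    exists2 d : R, 0 < d & forall e : R, 0 < e -> e < d ->
      psi (k0 - e) x0 * psi (k0 + e) x0 < 0)
  (K0 : forall x, K 0 x = 0)
  (K_lt : forall x p, W x -> K p x < K p.+1 x)
  (K_zero : forall x (k : R), W x -> 0 < k ->
     psi k x = 0 <-> exists2 p : nat, (0 < p)%N & K p x = k).

Lemma enumerated_lt x p q : W x -> (p < q)%N -> K p x < K q x.
Proof.
move=> Wx; elim: q => // q IH; rewrite ltnS leq_eqVlt => /orP[/eqP ->|/IH h].
  exact: K_lt.
exact: lt_trans h (K_lt _ Wx).
Qed.

Lemma enumerated_le x p q : W x -> (p <= q)%N -> K p x <= K q x.
Proof.
move=> Wx; rewrite leq_eqVlt => /orP[/eqP ->//|h]; exact/ltW/enumerated_lt.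
Qed.

Lemma enumerated_gt0 x p : W x -> (0 < p)%N -> 0 < K p x.
Proof. by move=> Wx p0; rewrite -(K0 x); exact: enumerated_lt. Qed.

Lemma enumerated_psi x p : W x -> (0 < p)%N -> psi (K p x) x = 0.
Proof.
move=> Wx p0; apply/(K_zero Wx); first exact: enumerated_gt0.
by exists p.
Qed.

Let psi_near (k : R) x : psi k x != 0 ->
  \forall k' \near k & y \near x, psi k' y != 0.
Proof.
move=> h; have := @cpsi (k, x) [set z | z != 0]; apply.
by apply: open_nbhs_nbhs; split => //; exact: open_neq.
Qed.

Let psi_slice (k : R) : continuous (psi k).
Proof.
move=> x; apply: (@continuous_comp _ _ _ (fun x => (k, x)) (fun p : R * T => psi p.1 p.2)).
  by apply: (@cvg_pair _ _ _ (nbhs x) (nbhs k) (nbhs x)); [exact: cvg_cst|exact: cvg_id].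
exact: cpsi.
Qed.

Let psi_slice' x : continuous (psi ^~ x).
Proof.
move=> k; apply: (@continuous_comp _ _ _ (fun k => (k, x)) (fun p : R * T => psi p.1 p.2)).
  by apply: (@cvg_pair _ _ _ (nbhs k) (nbhs k) (nbhs x)); [exact: cvg_id|exact: cvg_cst].
exact: cpsi.
Qed.

(** For index 0 this is the nonvanishing of [psi] near k = 0. For a positive index, a zero in the
    gap would lie so close to [K p x0] that local uniqueness identifies it with [K p x]. *)
Let gap p x0 : W x0 -> K p x @[x --> x0] --> K p x0 ->
  exists2 d : R, 0 < d & \forall x \near x0, forall k,
    K p x < k -> k < K p x0 + d -> psi k x != 0.
Proof.
case: p => [|p] Wx0 IH.
  have [[A B] /= [A0 Bx0] hAB] := psi_near (psi0 Wx0).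
  have [d /= d0 hd] := (nbhs_ballP _ _).1 A0.
  exists d => //; near=> y => k; have By : B y by near: y.
  rewrite !K0 add0r => k0 kd; apply: (hAB (k, y)); split => //=.
  by apply: hd; rewrite /= -ball_normE/= sub0r normrN gtr0_norm.
set c := K p.+1 x0; have cp : 0 < c by exact: enumerated_gt0.
have [d d0 hd] := psi_unique Wx0 cp (enumerated_psi Wx0 (ltn0Sn p)).
exists d => //.
have hc : \forall x \near x0, `|c - K p.+1 x| < d.
  exact: ((cvgrPdist_lt _ _).1 IH _ d0).
have oWx : \forall x \near x0, W x by exact: open_nbhs_nbhs.
near=> x => k kx kc; apply/eqP => psik.
have Wx : W x by near: x.
have Kx : `|c - K p.+1 x| < d by near: x.
have hu : forall k k' : R, `|k - c| < d -> `|k' - c| < d ->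
  psi k x = 0 -> psi k' x = 0 -> k = k' by near: x.
have kc' : `|k - c| < d.
  move: Kx; rewrite !ltr_norml => /andP[h1 h2]; apply/andP; split; lra.
rewrite distrC in Kx.
by move: kx; rewrite (hu _ _ kc' Kx psik (enumerated_psi Wx (ltn0Sn p))) ltxx.
Unshelve. all: by end_near. Qed.

(* Branches cannot cross (local uniqueness), cannot die (sign change), and no
   zero can appear between two consecutive ones (compactness). *)
Lemma enumerated_continuous p x0 : W x0 -> K p x @[x --> x0] --> K p x0.
Proof.
elim: p x0 => [|p IH] x0 Wx0.
  by rewrite (_ : K 0 = fun=> 0); [exact: cvg_cst|apply/funext => x; rewrite K0].
set c := K p x0; set e := K p.+1 x0.
have ce : c < e by exact: K_lt.
have c0 : 0 <= c by rewrite -(K0 x0); exact: enumerated_le.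
have e0 : 0 < e by exact: le_lt_trans ce.
have nW : \forall x \near x0, W x by exact: open_nbhs_nbhs.
have [d1 d10 hd1] := gap Wx0 (IH _ Wx0).
apply/cvgrPdist_le => eps eps0.
have [d2 d20 hd2] := psi_sign Wx0 e0 (enumerated_psi Wx0 (ltn0Sn p)).
(* [r < d2] gives the sign change, and [r <= (e - c) / 2] keeps the window [[e - r, e + r]] above
   [c + r], hence above [K p x]. *)
pose r := Num.min (eps / 2) (Num.min (d2 / 2) ((e - c) / 2)).
have r0 : 0 < r by rewrite !lt_min !divr_gt0// subr_gt0.
have r1 : r <= eps / 2 by rewrite ge_min lexx.
have r2 : r <= d2 / 2 by rewrite !ge_min lexx orbT.
have r3 : r <= (e - c) / 2 by rewrite !ge_min lexx !orbT.
have hneg : psi (e - r) x0 * psi (e + r) x0 < 0 by apply: hd2 => //; lra.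
have nneg : \forall x \near x0, psi (e - r) x * psi (e + r) x < 0.
  have : psi (e - r) x * psi (e + r) x @[x --> x0] --> psi (e - r) x0 * psi (e + r) x0.
    by apply: cvgM; exact: psi_slice.
  by move=> /(cvgr_lt _); apply.
(* At [x0] this segment contains no zero, as [c] and [e] are consecutive; compactness makes this
   persist for nearby [x]. *)
have ncov : \forall x \near x0, `[c + d1, e - r] `<=` [set k | psi k x != 0].
  have /compact_near_coveringP := @segment_compact R (c + d1) (e - r).
  apply => k /=; rewrite in_itv/= => /andP[k1 k2].
  apply: psi_near; apply/eqP => /(K_zero Wx0).
  have k0 : 0 < k by apply: lt_le_trans k1; exact: ltr_wpDl.
  move=> /(_ k0) [m m0 mk].
  have [mp|pm] := leqP m p.
    have := enumerated_le Wx0 mp; rewrite mk -/c; lra.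
  have := enumerated_le Wx0 pm; rewrite mk -/e; lra.
have nK : \forall x \near x0, `|c - K p x| < r.
  exact: ((cvgrPdist_lt _ _).1 (IH _ Wx0) _ r0).
near=> x.
have Wx : W x by near: x.
have h1 : forall k, K p x < k -> k < c + d1 -> psi k x != 0 by near: x.
have h2 : psi (e - r) x * psi (e + r) x < 0 by near: x.
have h3 : `[c + d1, e - r] `<=` [set k | psi k x != 0] by near: x; exact: ncov.
have h4 : `|c - K p x| < r by near: x.
move: h4; rewrite ltr_norml => /andP[h4 h5].
(* The sign change produces a zero within [r] of [e]. It exceeds [K p x], so its index is at least
   [p.+1], which bounds [K p.+1 x] from above. *)
have [z] : exists2 z, z \in `[e - r, e + r] & psi z x = 0.
  apply: IVT; first lra.
    by apply: continuous_subspaceT; exact: psi_slice'.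
  rewrite ge_min le_max.
  have [n1|n1|n1] := ltrgt0P (psi (e - r) x).
  - by move: h2; rewrite pmulr_rlt0// => /ltW ->; rewrite orbT.
  - by move: h2; rewrite nmulr_rlt0// => /ltW ->; rewrite orbT.
  - by [].
rewrite in_itv/= => /andP[z1 z2] psiz.
have z0 : 0 < z by lra.
have [m m0 mz] := (K_zero Wx z0).1 psiz.
have pm : (p < m)%N.
  rewrite ltnNge; apply/negP => mp; have := enumerated_le Wx mp; rewrite mz; lra.
have up : K p.+1 x <= e + r by have := enumerated_le Wx pm; rewrite mz; lra.
(* A smaller value would fall either into the gap above [K p x] or into the segment free of
   zeros. *)
have lo : e - r <= K p.+1 x.
  rewrite leNgt; apply/negP => lt.
  have pK := enumerated_psi Wx (ltn0Sn p).
  have [cK|Kc] := leP (c + d1) (K p.+1 x).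
    by have /h3 /= : `[c + d1, e - r]%classic (K p.+1 x); rewrite ?pK ?eqxx//= in_itv/= cK ltW.
  by have := h1 _ (K_lt p Wx) Kc; rewrite pK eqxx.
rewrite ler_norml; apply/andP; split; lra.
Unshelve. all: by end_near. Qed.

End EnumeratedZeros.

(** * Inverse functions from two-point difference quotients *)

Section MatrixNorm.
Variable R : realType.

Lemma mx_norm_entry m n (A : 'M[R]_(m, n)) i j : `|A i j| <= `|A|.
Proof.
rewrite [leRHS]/Num.norm/= mx_normrE.
by apply/bigmax_geP; right => /=; exists (i, j).
Qed.

Lemma mx_norm_le m n (A : 'M[R]_(m, n)) (c : R) : 0 <= c ->
  (forall i j, `|A i j| <= c) -> `|A| <= c.
Proof.
move=> c0 h; rewrite [leLHS]/Num.norm/= mx_normrE.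
by apply/bigmax_leP; split => // -[i j] _; exact: h.
Qed.

(** For the maximum norm, submultiplicativity costs a factor equal to the inner dimension; hence the
    powers of [n] in the constants below. *)
Lemma mulmx_norm m n p (A : 'M[R]_(m, n)) (B : 'M[R]_(n, p)) :
  `|A *m B| <= n%:R * `|A| * `|B|.
Proof.
apply: mx_norm_le; first by rewrite !mulr_ge0.
move=> i j; rewrite mxE; apply: le_trans (ler_norm_sum _ _ _) _.
rewrite -mulrA -[n in n%:R]card_ord -sumr_const mulr_suml; apply: ler_sum => k _.
by rewrite mul1r normrM ler_pM// mx_norm_entry.
Qed.

Lemma trmx_norm m n (A : 'M[R]_(m, n)) : `|A^T| <= `|A|.
Proof. by apply: mx_norm_le => // i j; rewrite mxE mx_norm_entry. Qed.

(** Right multiplication by 1 - M B fixes the left kernel of M and at least halves norms, so this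
    kernel is zero. *)
Lemma unitmx_near n (M B : 'M[R]_n) : n%:R * `|1%:M - M *m B| <= 1 / 2 -> M \in unitmx.
Proof.
move=> h; rewrite -row_free_unit -kermx_eq0 -normr_le0.
have e : kermx M *m (1%:M - M *m B) = kermx M.
  by rewrite mulmxBr mulmx1 mulmxA mulmx_ker mul0mx subr0.
have := mulmx_norm (kermx M) (1%:M - M *m B); rewrite e => h1.
have h2 : n%:R * `|kermx M| * `|1%:M - M *m B| <= `|kermx M| * (1 / 2).
  by rewrite mulrAC mulrC ler_wpM2l.
lra.
Qed.

(** With B the inverse of M0, B - M^-1 = -M^-1 (M0 - M) B. This first yields |M^-1| <= 2 |B|, and
    then the estimate. *)
Lemma invmx_continuous n (M0 : 'M[R]_n) : M0 \in unitmx -> {for M0, continuous (@invmx R n : 'M[R]_n -> 'M[R]_n)}.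
Proof.
move=> u0; set B := invmx M0.
apply/(@cvgrPdist_le _ _ _ (nbhs M0)) => e e0.
set N : R := n%:R; have N0 : 0 <= N by [].
(* The first bound serves the invertibility of [M] and [|invmx M| <= 2 * |B|], the second the final
   estimate by [e]. *)
pose d := Num.min (1 / 2 / (1 + N * N * `|B|)) (e / (1 + 2 * N * N * `|B| * `|B|)).
have p1 : 0 < 1 + N * N * `|B| by rewrite ltr_pwDl// !mulr_ge0.
have p2 : 0 < 1 + 2 * N * N * `|B| * `|B| by rewrite ltr_pwDl// !mulr_ge0.
have d0 : 0 < d by rewrite lt_min !divr_gt0.
have near_d : \forall M \near M0, `|M0 - M| < d.
  by apply/nbhs_ballP; exists d => // M; rewrite -ball_normE.
near=> M.
have hM : `|M0 - M| < d by near: M.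
have h1 : `|M0 - M| * (1 + N * N * `|B|) <= 1 / 2.
  by rewrite -ler_pdivlMr//; apply: le_trans (ltW hM) _; rewrite ge_min lexx.
have h2 : `|M0 - M| * (1 + 2 * N * N * `|B| * `|B|) <= e.
  by rewrite -ler_pdivlMr//; apply: le_trans (ltW hM) _; rewrite ge_min lexx orbT.
have uM : M \in unitmx.
  apply: (@unitmx_near _ _ B).
  have -> : 1%:M - M *m B = (M0 - M) *m B by rewrite mulmxBl mulmxV.
  apply: le_trans (_ : N * (N * `|M0 - M| * `|B|) <= _).
    by rewrite ler_wpM2l// mulmx_norm.
  have := normr_ge0 (M0 - M); lra.
have eM : B - invmx M = - (invmx M *m ((M0 - M) *m B)).
  by rewrite mulmxBl mulmxBr mulmxV// mulmx1 mulmxA mulVmx// mul1mx opprB.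
have nB : `|B - invmx M| <= N * `|invmx M| * (N * `|M0 - M| * `|B|).
  rewrite eM normrN; apply: le_trans (mulmx_norm _ _) _.
  by rewrite ler_wpM2l ?mulr_ge0// mulmx_norm.
have nM : `|invmx M| <= 2 * `|B|.
  have := ler_normB B (B - invmx M); rewrite opprB addrCA subrr addr0 => h3.
  have h4 : `|invmx M| * (N * N * `|M0 - M| * `|B|) <= `|invmx M| * (1 / 2).
    rewrite ler_wpM2l//; have := normr_ge0 (M0 - M); lra.
  lra.
apply: le_trans nB _; apply: le_trans h2.
have h5 : `|invmx M| * (N * N * `|M0 - M| * `|B|) <= (2 * `|B|) * (N * N * `|M0 - M| * `|B|).
  by rewrite ler_wpM2r// !mulr_ge0.
have := normr_ge0 (M0 - M); lra.
Unshelve. all: by end_near. Qed.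

End MatrixNorm.

Lemma differentiable_of_remainder (R : realType) (V W : normedModType R)
    (f : V -> W) (df : {linear V -> W}) (x : V) : continuous df ->
  (forall e : R, 0 < e -> \forall h \near 0, `|f (h + x) - f x - df h| <= e * `|h|) ->
  differentiable f x /\ 'd f x = df :> (V -> W).
Proof.
move=> cdf hf.
have hdf : f \o shift x = cst (f x) + df +o_ 0 id.
  apply/eqaddoP => e e0; have := hf e e0; apply: filterS => h.
  by rewrite !fctE /= opprD addrA.
have dF : 'd f x = df :> (V -> W) by exact: diff_unique.
by split => //; apply/diff_locallyP; rewrite dF.
Qed.

(** * Difference quotients and the inverse function theorem *)

Section DifferenceQuotient.
Variables (R : realType) (n : nat).
Local Notation N := n.+1.
Local Notation V := 'rV[R]_n.+1.
Implicit Types (F : V -> V) (G : V -> V -> 'M[R]_n.+1).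

(* Strict differentiability, in a form that passes to the inverse map: the
   quotient of the inverse is the inverse matrix of the quotient. *)
Definition difference_quotient F G (x : V) : Prop :=
  (\forall y \near x & z \near x, F y - F z = (y - z) *m G y z) /\
  (fun p : V * V => G p.1 p.2) @ (x, x) --> G x x.

Lemma difference_quotient_near F G x (e : R) : difference_quotient F G x -> 0 < e ->
  exists2 d : R, 0 < d & forall y z, `|x - y| < d -> `|x - z| < d ->
    F y - F z = (y - z) *m G y z /\ `|G x x - G y z| < e.
Proof.
move=> [hF hG] e0.
have [[A1 B1] /= [A1x B1x] h1] := hF.
have [[A2 B2] /= [A2x B2x] h2] := (cvgrPdist_lt _ _).1 hG _ e0.
have [d d0 hd] : exists2 d : R, 0 < d & ball x d `<=` (A1 `&` B1) `&` (A2 `&` B2).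
  have [d /= d0 hd] := (nbhs_ballP _ _).1 (filterI (filterI A1x B1x) (filterI A2x B2x)).
  by exists d.
exists d => // y z xy xz.
have [[y1 y1'] [y2 y2']] : ((A1 `&` B1) `&` (A2 `&` B2)) y.
  by apply: hd; rewrite -ball_normE.
have [[z1 z1'] [z2 z2']] : ((A1 `&` B1) `&` (A2 `&` B2)) z.
  by apply: hd; rewrite -ball_normE.
split; first exact: (h1 (y, z)).
exact: (h2 (y, z)).
Qed.

Lemma mulmxr_continuous (B : 'M[R]_N) : continuous (fun v : V => v *m B).
Proof.
apply/(linear_bounded_continuous (mulmxr B : {linear V -> V}))/linear_boundedP.
near=> r => h /=; apply: le_trans (mulmx_norm _ _) _.
rewrite mulrAC ler_wpM2r//; near: r; apply: nbhs_pinfty_ge; exact: num_real.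
Unshelve. all: by end_near. Qed.

(** Taking z = x, the remainder is h (G (h + x) x - G x x), which is o(h). *)
Lemma difference_quotient_diff F G x : difference_quotient F G x ->
  differentiable F x /\ forall h, 'd F x h = h *m G x x.
Proof.
move=> hFG.
pose df : {linear V -> V} := mulmxr (G x x).
have cdf : continuous df by exact: mulmxr_continuous.
have [|dF dE] := @differentiable_of_remainder R V V F df x cdf.
- move=> e e0.
  have e1 : 0 < e / N%:R by rewrite divr_gt0.
  have [d d0 hd] := difference_quotient_near hFG e1.
  have near_d : \forall h \near (0 : V), `|h| < d.
    by apply/nbhs_ballP; exists d => // h; rewrite -ball_normE/= sub0r normrN.
  near=> h.
  have hh : `|h| < d by near: h.
  have h1 : `|x - (h + x)| < d by rewrite opprD addrCA subrr addr0 normrN.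
  have h2 : `|x - x| < d by rewrite subrr normr0.
  have [e2 hG] := hd (h + x) x h1 h2.
  rewrite e2 addrK /= -mulmxBr.
  apply: le_trans (mulmx_norm _ _) _; rewrite distrC mulrAC ler_wpM2r//.
  by rewrite mulrC -ler_pdivlMr// ltW.
- by split => // h; rewrite dE.
Unshelve. all: by end_near. Qed.

Lemma difference_quotient_Jacobian F G x : difference_quotient F G x ->
  Jacobian_matrix F x = (G x x)^T.
Proof.
move=> /difference_quotient_diff[_ dF]; congr (_ ^T); apply/row_matrixP => i.
by rewrite !rowE /jacobian mul_rV_lin1 dF.
Qed.

(** The Jacobian at y is the transpose of [G y y], so its continuity is the convergence of [G]
    restricted to the diagonal. *)
Lemma difference_quotient_C1 F G (O : set V) : open O ->
  (forall x, O x -> difference_quotient F G x) -> C1_on F O.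
Proof.
move=> oO h x Ox; split; first by have [] := difference_quotient_diff (h _ Ox).
apply/(@cvgrPdist_le _ _ _ (nbhs x)) => e e0.
have [d d0 hd] := difference_quotient_near (h _ Ox) e0.
have near_d : \forall y \near x, `|x - y| < d.
  by apply/nbhs_ballP; exists d => // y; rewrite -ball_normE.
near=> y.
have Oy : O y by near: y; exact: open_nbhs_nbhs.
have xy : `|x - y| < d by near: y.
rewrite (difference_quotient_Jacobian (h _ Ox)) (difference_quotient_Jacobian (h _ Oy)).
rewrite -linearB/=; apply: le_trans (trmx_norm _) _.
by have [_ /ltW] := hd y y xy xy.
Unshelve. all: by end_near. Qed.

(** A contraction estimate on a ball gives injectivity and openness. The local inverse then has the
    difference quotient [H], the inverse matrix of [G] at the preimages, and
    [difference_quotient_C1] applies to it. *)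
Lemma inverse_function F G (W : set V) (a : V) : open W -> W a ->
  (forall x, W x -> difference_quotient F G x) -> G a a \in unitmx ->
  locally_invertible F a.
Proof.
move=> oW Wa hFG uG; set A := invmx (G a a).
have A0 : 0 < 1 + N%:R * N%:R * `|A| by rewrite ltr_pwDl// !mulr_ge0.
(* This closeness to [G a a] makes n |1 - G y z A| at most 1/2, which gives both the invertibility
   of [G y z] and the contraction. *)
have e0 : 0 < 1 / 2 / (1 + N%:R * N%:R * `|A|) by rewrite !divr_gt0.
have [d1 d10 hd1] := difference_quotient_near (hFG _ Wa) e0.
have [d2 /= d20 hd2] := (nbhs_ballP _ _).1 (open_nbhs_nbhs (conj oW Wa)).
pose d := Num.min d1 d2.
have d0 : 0 < d by rewrite lt_min d10.
pose U : set V := ball a d.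
have UE x : U x = (`|a - x| < d) by rewrite /U -ball_normE.
have UW : U `<=` W.
  move=> x; rewrite UE => ax; apply: hd2; rewrite -ball_normE/=.
  by apply: lt_le_trans ax _; rewrite ge_min lexx orbT.
have FG y z : U y -> U z -> F y - F z = (y - z) *m G y z /\
    N%:R * `|1%:M - G y z *m A| <= 1 / 2.
  rewrite !UE => ay az.
  have dd1 : d <= d1 by rewrite ge_min lexx.
  have [-> hG] := hd1 y z (lt_le_trans ay dd1) (lt_le_trans az dd1); split => //.
  have -> : 1%:M - G y z *m A = (G a a - G y z) *m A by rewrite mulmxBl mulmxV.
  apply: le_trans (_ : N%:R * (N%:R * `|G a a - G y z| * `|A|) <= _).
    by rewrite ler_wpM2l// mulmx_norm.
  move: hG; rewrite ltr_pdivlMr// => hG.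
  have := normr_ge0 (G a a - G y z); lra.
have uGU y z : U y -> U z -> G y z \in unitmx.
  by move=> Uy Uz; apply: (@unitmx_near _ _ _ A); have [] := FG y z Uy Uz.
(* Newton's map with frozen derivative: since [A] is invertible, its fixed points are the solutions
   of F x = w. *)
pose T (w x : V) := x - (F x - w) *m A.
have T_contr w y z : U y -> U z -> `|T w y - T w z| <= 1 / 2 * `|y - z|.
  move=> Uy Uz; have [h1 h2] := FG y z Uy Uz.
  have -> : T w y - T w z = (y - z) *m (1%:M - G y z *m A).
    rewrite mulmxBr mulmx1 mulmxA -h1 /T !mulmxBl.
    move: (F y *m A) (F z *m A) (w *m A) => Y Z X.
    by apply/rowP => i; rewrite !mxE; ring.
  apply: le_trans (mulmx_norm _ _) _.
  by rewrite mulrAC ler_wpM2r.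
pose C := 2 * N%:R * `|A|.
have C0 : 0 <= C by rewrite !mulr_ge0.
have inv_lip y z : U y -> U z -> `|y - z| <= C * `|F y - F z|.
  move=> Uy Uz; have h := T_contr 0 y z Uy Uz.
  have e : y - z = (T 0 y - T 0 z) + (F y - F z) *m A.
    rewrite /T !mulmxBl; move: (F y *m A) (F z *m A) (0 *m A) => Y Z X.
    by apply/rowP => i; rewrite !mxE; ring.
  have := ler_normD (T 0 y - T 0 z) ((F y - F z) *m A); rewrite -e => h1.
  have h2 := mulmx_norm (F y - F z) A.
  rewrite /C; lra.
have inj y z : U y -> U z -> F y = F z -> y = z.
  move=> Uy Uz e; have := inv_lip y z Uy Uz.
  by rewrite e subrr normr0 mulr0 normr_le0 subr_eq0 => /eqP.
(* No iteration is run: on a compact ball mapped into itself by [T w], take a minimum point of |T w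
   x - x| = |(F x - w) A|. Applying [T w] there at least halves the value, so the minimum is 0. *)
have oFU : open (F @` U).
  rewrite openE => _ [x0 Ux0 <-].
  have ax0 : `|a - x0| < d by rewrite -UE.
  pose r := (d - `|a - x0|) / 2.
  have r0 : 0 < r by rewrite divr_gt0// subr_gt0.
  pose B : set V := [set x | `|x0 - x| <= r].
  have BU : B `<=` U.
    move=> x Bx; have Bx' : `|x0 - x| <= (d - `|a - x0|) / 2 by exact: Bx.
    rewrite UE; have := ler_normD (a - x0) (x0 - x); rewrite addrA subrK; lra.
  have CA : 0 < 1 + N%:R * `|A| by rewrite ltr_pwDl// mulr_ge0.
  have q0 : 0 < r / 2 / (1 + N%:R * `|A|).
    by apply: divr_gt0 CA; apply: divr_gt0 r0 _.
  (* For such [w] the centre [x0] moves by at most r/2 under [T w]; with the contraction ratio 1/2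
     the ball of radius [r] is preserved. *)
  apply/nbhs_ballP; exists (r / 2 / (1 + N%:R * `|A|)); first exact: q0.
  move=> w; rewrite -ball_normE/= ltr_pdivlMr// => hw.
  have hw' : `|(F x0 - w) *m A| <= r / 2.
    apply: le_trans (mulmx_norm _ _) _.
    have := normr_ge0 (F x0 - w); lra.
  have TB x : B x -> B (T w x).
    move=> Bx; rewrite /B/=.
    have e : x0 - T w x = (F x0 - w) *m A + (T w x0 - T w x).
      rewrite /T; move: ((F x0 - w) *m A) ((F x - w) *m A) => Y Z.
      by apply/rowP => i; rewrite !mxE; ring.
    rewrite e; apply: le_trans (ler_normD _ _) _.
    have Bx' : `|x0 - x| <= r by exact: Bx.
    have := T_contr w x0 x Ux0 (BU _ Bx); lra.
  have cB : compact B.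
    apply: bounded_closed_compact; last exact: (@closed_closed_ball_ _ V x0 r).
    exists (`|x0| + r); split; [exact: num_real|move=> M xM x Bx].
    have Bx' : `|x0 - x| <= r by exact: Bx.
    have := ler_normB x0 (x0 - x); rewrite opprB addrCA subrr addr0 /=; lra.
  have Bx0 : B x0 by rewrite /B/= subrr normr0 ltW.
  have cg : {within B, continuous (fun x => `|(F x - w) *m A|)}.
    apply: continuous_in_subspaceT => x; rewrite inE => Bx.
    have [dF _] := difference_quotient_diff (hFG _ (UW _ (BU _ Bx))).
    have h1 : (fun x => F x - w) @ x --> F x - w.
      exact: (cvgB (differentiable_continuous dF) (cvg_cst w)).
    have h2 := cvg_comp _ _ h1 (@mulmxr_continuous A (F x - w)).
    exact: (@cvg_norm _ V _ _ _ _ _ h2).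
  have [|c] := EVT_min_rV _ cB cg; first by exists x0.
  rewrite inE => Bc hc.
  have Uc := BU _ Bc.
  have := hc (T w c); rewrite inE => /(_ (TB _ Bc)) h1.
  have h2 := T_contr w (T w c) c (BU _ (TB _ Bc)) Uc.
  have e1 x : T w x - x = - ((F x - w) *m A).
    by rewrite /T addrAC subrr add0r.
  have e2 : T w (T w c) - T w c = - ((F (T w c) - w) *m A) by exact: e1.
  rewrite e2 e1 !normrN in h2.
  have h3 : `|(F c - w) *m A| <= 0 by lra.
  exists c => //; apply/eqP; rewrite -subr_eq0 -[F c - w]mulmx1 -(mulVmx uG) mulmxA.
  by move: h3; rewrite normr_le0 => /eqP ->; rewrite mul0mx.
(* The default value [a] is taken only outside the image of [U]. *)
pose g (w : V) : V := xget a [set x | U x /\ F x = w].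
have gF x : U x -> g (F x) = x.
  move=> Ux; rewrite /g; case: xgetP => [y -> [Uy]|/(_ x)]; last by case.
  exact: inj.
have oU : open U by exact: ball_open.
have Ua : U a by rewrite UE subrr normr0.
exists U, g; split; first by apply: And3.
apply: And3; [exact: gF| |].
  by apply: (@difference_quotient_C1 F G) => // x /UW; exact: hFG.
pose H w w' := invmx (G (g w) (g w')).
apply: (@difference_quotient_C1 g H _ oFU) => _ [x0 Ux0 <-].
have nFU : nbhs (F x0) (F @` U) by apply: open_nbhs_nbhs; split => //; exists x0.
split.
  exists (F @` U, F @` U) => //= -[_ _] /= [[y Uy <-] [z Uz <-]].
  have [-> _] := FG y z Uy Uz.
  by rewrite /H !gF// mulmxK// uGU.
(* Continuity of the inverse is the Lipschitz bound [inv_lip]. *)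
have cgx : g w @[w --> F x0] --> x0.
  apply/(@cvgrPdist_le _ _ _ (nbhs (F x0))) => e e1.
  have C1 : 0 < 1 + C by rewrite ltr_pwDl.
  have nd : \forall w \near F x0, `|F x0 - w| < e / (1 + C).
    by apply/nbhs_ballP; exists (e / (1 + C)); [rewrite /= divr_gt0|move=> w; rewrite -ball_normE].
  near=> w.
  have [y Uy yw] : (F @` U) w by near: w.
  have : `|F x0 - w| < e / (1 + C) by near: w.
  rewrite -yw gF// ltr_pdivlMr// => h1.
  apply: le_trans (inv_lip _ _ Ux0 Uy) _; have := normr_ge0 (F x0 - F y); lra.
have [_ cG] := hFG _ (UW _ Ux0).
have cp : (fun p : V * V => (g p.1, g p.2)) @ (F x0, F x0) --> (x0, x0).
  apply: (@cvg_pair _ _ _ (nbhs (F x0, F x0)) (nbhs x0) (nbhs x0)).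
    by apply: cvg_comp cgx; exact: cvg_fst.
  by apply: cvg_comp cgx; exact: cvg_snd.
have := cvg_comp _ _ (cvg_comp _ _ cp cG) (invmx_continuous (uGU _ _ Ux0 Ux0)).
by rewrite /H !gF.
Unshelve. all: by end_near. Qed.

Lemma mulmx_jacobian F (a v : V) : v *m jacobian F a = 'd F a v.
Proof. by rewrite /jacobian mul_rV_lin1. Qed.

(** Differentiating g (F x) = x at [a] yields a one-sided inverse of the square matrix
    [jacobian F a]. *)
Lemma locally_invertible_unit F (a : V) : locally_invertible F a ->
  Jacobian_matrix F a \in unitmx.
Proof.
move=> [U [g [[oU Ua oFU] [gF cF cg]]]].
have [dF _] := cF _ Ua.
have [dg _] := cg _ (ex_intro2 _ _ a Ua erefl : (F @` U) (F a)).
have dgF v : 'd g (F a) ('d F a v) = v.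
  have e := @diff_comp R V V V F g a dF dg.
  have e1 : 'd g (F a) ('d F a v) = 'd (g \o F) a v.
    exact: (esym (congr1 (fun h : V -> V => h v) e)).
  have dgF : differentiable (g \o F) a := @differentiable_comp R V V V F g a dF dg.
  rewrite e1 -(@deriveE R V V (g \o F) a v dgF).
  have nid : \forall x \near a, id x = (g \o F) x.
    by have := open_nbhs_nbhs (conj oU Ua); apply: filterS => x /gF.
  by rewrite -(@near_eq_derive R V V id (g \o F) a v nid) derive_id.
rewrite /Jacobian_matrix unitmx_tr.
have hJ : jacobian F a *m jacobian g (F a) = 1%:M.
  apply/row_matrixP => i; rewrite !rowE mulmxA mulmx1.
  have e1 := mulmx_jacobian F a (delta_mx 0 i).
  have e2 := mulmx_jacobian g (F a) ('d F a (delta_mx 0 i)).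
  by rewrite [X in X *m _]e1 e2 dgF.
have [uF _] := mulmx1_unit hJ.
exact uF.
Qed.

End DifferenceQuotient.

(** * The radial problem *)

(** Connects the integral in the normalisation of eigenfunctions with the primitive that defines
    [inner]. *)
Lemma Rintegral_primitive (R : realType) (a b : R) (f : R -> R) : a < b -> continuous f ->
  \int[lebesgue_measure]_(x in `[a, b]) f x = primitive a b f b.
Proof.
move=> ab cf; rewrite /Rintegral (@continuous_FTC2 _ f (primitive a b f))//.
- by rewrite primitive_left//= subr0.
- exact: continuous_subspaceT.
- have cp := primitive_continuous ab cf; split.
  + move=> x xab; have h := primitive_derive cf xab; exact: ex_derive.
  + exact: cvg_at_right_filter (cp a).
  + exact: cvg_at_left_filter (cp b).
- by move=> x xab; have h := primitive_derive cf xab; rewrite derive1E derive_val.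
Qed.

Lemma is_derive_exprf (R : realType) (n : nat) (x : R) :
  is_derive x 1 (fun z : R => z ^+ n) (n%:R * x ^+ n.-1).
Proof.
elim: n => [|n IH].
  by rewrite mul0r (_ : (fun z : R => z ^+ 0) = fun=> 1)//; exact: is_derive_cstf.
have -> : (fun z : R => z ^+ n.+1) = (fun z => z * z ^+ n).
  by apply/funext => z; rewrite exprS.
apply: (is_derive_eq (is_derive_mulf (is_derive_idf x) IH)).
by case: n {IH} => [|n]; rewrite /= ?expr0 ?exprS -?natr1; ring.
Qed.

(** * The radial equation as a linear system *)

Section RadialCoefficients.
Variables (R : realType) (d l : nat) (R1 R2 : R).
Hypotheses (hd : (2 <= d)%N) (hR1 : 0 < R1) (hR12 : R1 < R2).

(* The coefficients are frozen outside [R1, R2] so as to be continuous and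
   bounded on the whole line. *)
Definition weight (r : R) : R := clamp R1 R2 r ^+ d.-1.

(** The factor [weight r] comes from multiplying the radial equation by r^(d-1). *)
Definition potential (r : R) : R :=
  (l * (l + d - 2))%:R / clamp R1 R2 r ^+ 2 * weight r.

Let clamp_ge r : R1 <= clamp R1 R2 r <= R2.
Proof. by have := clamp_itv hR12 r; rewrite in_itv. Qed.

Let clamp_gt0 r : 0 < clamp R1 R2 r.
Proof. by have /andP[+ _] := clamp_ge r; exact: lt_le_trans. Qed.

Lemma weight_gt0 r : 0 < weight r.
Proof. by rewrite exprn_gt0. Qed.

Lemma potential_ge0 r : 0 <= potential r.
Proof. by rewrite mulr_ge0 ?(ltW (weight_gt0 r))// divr_ge0// sqr_ge0. Qed.

Lemma weight_continuous : continuous weight.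
Proof.
move=> x; apply: (@continuous_comp _ _ _ (clamp R1 R2) (fun r : R => r ^+ d.-1)).
  exact: clamp_continuous.
exact: exprn_continuous.
Qed.

Lemma potential_weight_continuous : continuous potential.
Proof.
move=> x; apply: cvgM; last exact: weight_continuous.
apply: cvgM; first exact: cvg_cst.
apply: cvgV; first by rewrite gt_eqF// exprn_gt0.
apply: (@continuous_comp _ _ _ (clamp R1 R2) (fun r : R => r ^+ 2)).
  exact: clamp_continuous.
exact: exprn_continuous.
Qed.

Lemma coefficients_bounded : exists M : R,
  [/\ forall r, weight r <= M, forall r, (weight r)^-1 <= M &
      forall r, `|potential r| <= M].
Proof.
pose c : R := (l * (l + d - 2))%:R.
have c0 : 0 <= c by exact: ler0n.
have hw r : R1 ^+ d.-1 <= weight r <= R2 ^+ d.-1.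
  have /andP[h1 h2] := clamp_ge r.
  have c0' := clamp_gt0 r.
  have r1 := ltW hR1; have r3 := ltW c0'; have r2 := le_trans r3 h2.
  by rewrite /weight !lerXn2r ?nnegrE.
have p1 : 0 < R1 ^+ d.-1 by rewrite exprn_gt0.
have p2 : 0 < R2 ^+ d.-1 by rewrite exprn_gt0// (lt_trans hR1).
have q0 : 0 <= c / R1 ^+ 2 * R2 ^+ d.-1.
  by apply: mulr_ge0 (ltW p2); apply: divr_ge0 c0 (sqr_ge0 _).
exists (R2 ^+ d.-1 + (R1 ^+ d.-1)^-1 + c / R1 ^+ 2 * R2 ^+ d.-1).
have i1 : 0 < (R1 ^+ d.-1)^-1 by rewrite invr_gt0.
split=> r; have /andP[w1 w2] := hw r.
- lra.
- have : (weight r)^-1 <= (R1 ^+ d.-1)^-1 by rewrite lef_pV2// posrE weight_gt0.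
  lra.
- rewrite ger0_norm ?potential_ge0//.
  have : potential r <= c / R1 ^+ 2 * R2 ^+ d.-1.
    apply: ler_pM => //; [by rewrite divr_ge0// sqr_ge0|exact: ltW (weight_gt0 r)|].
    rewrite ler_wpM2l// lef_pV2 ?posrE ?exprn_gt0// lerXn2r ?nnegrE ?(ltW hR1) ?(ltW (clamp_gt0 r))//.
    by have /andP[] := clamp_ge r.
  lra.
Qed.

Let oc (r : R) : r \in `]R1, R2[ -> r \in `[R1, R2].
Proof. by rewrite !in_itv/= => /andP[h1 h2]; rewrite !ltW. Qed.

Let oo_gt0 (r : R) : r \in `]R1, R2[ -> 0 < r.
Proof. by rewrite in_itv/= => /andP[+ _]; exact: lt_trans. Qed.

Lemma weightE (r : R) : r \in `[R1, R2] -> weight r = r ^+ d.-1.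
Proof. by move=> h; rewrite /weight clamp_id. Qed.

Lemma weight_derive (r : R) : r \in `]R1, R2[ ->
  is_derive r 1 weight (d.-1%:R / r * weight r).
Proof.
move=> rab; have r0 := oo_gt0 rab.
have hX : is_derive r 1 (fun z : R => z ^+ d.-1) (d.-1%:R / r * weight r).
  apply: (is_derive_eq (is_derive_exprf d.-1 r)).
  rewrite weightE ?oc//; case: d hd => // -[//|d' _] /=.
  by rewrite exprS; field; exact: lt0r_neq0.
apply: (near_eq_is_derive _ hX).
by have := near_in_itvoo rab; apply: filterS => z /oc /weightE ->.
Qed.

Local Notation sol := (radial_system R1 R2 weight potential).

Lemma radial_eigenfunction_system (a1 a2 lam : R) (e : R -> R) :
  radial_eigenfunction d l R1 R2 a1 a2 lam e ->
  exists2 v, sol lam e v &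
    [/\ v R1 = a1 * weight R1 * e R1, v R2 = - (a2 * weight R2 * e R2) &
        exists2 r, r \in `[R1, R2] & e r != 0].
Proof.
move=> [e' [e'' [[ce ce'] he b1 b2 nz]]].
exists (fun r => weight r * e' r); last first.
  have -> : e' R1 = a1 * e R1 by lra.
  have -> : e' R2 = - (a2 * e R2) by lra.
  by split=> //; ring.
split=> //.
- by apply: within_mul => //; apply: continuous_subspaceT; exact: weight_continuous.
- move=> r rab; have [h1 _ _] := he r rab.
  by rewrite mulrC mulKf// gt_eqF// weight_gt0.
- move=> r rab; have [_ h2 eq] := he r rab.
  apply: (is_derive_eq (is_derive_mulf (weight_derive rab) h2)).
  have r0 : r != 0 by rewrite gt_eqF// oo_gt0.
  have -> : e'' r = - (d.-1%:R / r * e' r) -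
    (lam - (l * (l + d - 2))%:R / r ^+ 2) * e r by lra.
  rewrite /potential clamp_id ?oc//; ring.
Qed.

Lemma system_radial_eigenfunction (a1 a2 lam : R) (u v : R -> R) :
  sol lam u v -> v R1 = a1 * weight R1 * u R1 -> v R2 = - (a2 * weight R2 * u R2) ->
  u R1 != 0 -> radial_eigenfunction d l R1 R2 a1 a2 lam u.
Proof.
move=> [cu cv du dv] v1 v2 nz.
pose u' r := v r / weight r.
exists u', (fun r => - (d.-1%:R / r * u' r) -
    (lam - (l * (l + d - 2))%:R / r ^+ 2) * u r).
have w0 r : weight r != 0 by rewrite gt_eqF// weight_gt0.
split.
- split=> //; apply: within_mul => //; apply: continuous_subspaceT => r.
  by apply: cvgV => //; exact: weight_continuous.
- move=> r rab; split; first exact: du.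
    have dV : is_derive r 1 (fun y => (weight y)^-1)
        (- weight r ^- 2 * (d.-1%:R / r * weight r)).
      exact: is_deriveV (w0 r) (weight_derive rab).
    apply: (is_derive_eq (is_derive_mulf (dv _ rab) dV)).
    have r0 : r != 0 by rewrite gt_eqF// oo_gt0.
    rewrite /u' /potential clamp_id ?oc//.
    have := w0 r; move: (weight r) => w wn0;  by field; rewrite r0.
  ring.
- by rewrite /u' v1; field.
- by rewrite /u' v2; field.
- by exists R1 => //; rewrite in_itv/= lexx ltW.
Qed.

End RadialCoefficients.

Lemma mx_cvg (R : realType) (T : Type) (F : set_system T) (FF : Filter F) m n
    (f : T -> 'M[R]_(m, n)) (A : 'M[R]_(m, n)) :
  (forall i j, f t i j @[t --> F] --> A i j) -> f @ F --> A.
Proof.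
move=> h; apply/(@cvgrPdist_le _ _ _ F) => e e0.
have hn : \forall t \near F, forall i j, `|A i j - f t i j| <= e.
  apply: filter_forall => i; apply: filter_forall => j.
  exact: ((cvgrPdist_le _ _).1 (h i j) e e0).
near=> t; apply: mx_norm_le; first exact: ltW.
move=> i j; rewrite !mxE.
have ht : forall i j, `|A i j - f t i j| <= e by near: t.
exact: ht.
Unshelve. all: by end_near. Qed.

(** * Resonances as zeros of the characteristic function *)

Section Resonances.
Variables (R : realType) (d l : nat) (R1 R2 : R) (k : nat -> R -> R -> R).
Hypotheses (hd : (2 <= d)%N) (hR1 : 0 < R1) (hR12 : R1 < R2)
  (hk : is_resonance_family d l R1 R2 k).
Variables (U V : R * R -> R -> R).
Local Notation P := (weight d R1 R2).
Local Notation Q := (potential d l R1 R2).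
Hypotheses (cU : forall t, continuous (U t))
  (UV : forall t, radial_system R1 R2 P Q t.1 (U t) (V t))
  (Ua : forall t, U t R1 = 1) (Va : forall t, V t R1 = t.2).
Local Notation V2 := 'rV[R]_2.

Let P0 := weight_gt0 d hR1 hR12.
Let cP : continuous P. Proof. exact: weight_continuous. Qed.
Let Q0 := potential_ge0 d l hR1 hR12.
Let inb : R2 \in `[R1, R2]. Proof. by rewrite in_itv/= lexx ltW. Qed.
Local Notation ip := (inner R1 R2 P U).
Local Notation chi := (char_fun R2 U V).

(** The condition at R1 fixes the initial data up to the factor [e R1], so uniqueness makes [e] a
    multiple of [U]; nontriviality forces [e R1 != 0], and the condition at R2 becomes the
    characteristic equation. *)
Lemma eigenfunction_multiple (a1 a2 lam : R) (e : R -> R) :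
  radial_eigenfunction d l R1 R2 a1 a2 lam e ->
  [/\ e R1 != 0, forall r, r \in `[R1, R2] -> e r = e R1 * U (lam, a1 * P R1) r &
      chi (lam, a1 * P R1) (a2 * P R2) = 0].
Proof.
move=> /(radial_eigenfunction_system hd hR1 hR12)[v sv [v1 v2 nz]].
have [M [PM PVM QM]] := coefficients_bounded d l hR1 hR12.
set t := (lam, a1 * P R1).
have h := radial_system_unique hR12 P0 PM PVM QM sv
  (radial_system_scale (e R1) (UV t)).
have {}h r : r \in `[R1, R2] -> e r = e R1 * U t r /\ v r = e R1 * V t r.
  by apply: h; [rewrite Ua mulr1|rewrite Va v1 mulrC].
have e0 : e R1 != 0.
  apply/eqP => e0; case: nz => r rab; have [-> _] := h r rab.
  by rewrite e0 mul0r eqxx.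
split=> //; first by move=> r /h[].
have [h1 h2] := h _ inb; apply: (mulfI e0).
rewrite mulr0 /char_fun mulrDr -h2 v2 h1; ring.
Qed.

Let x1 (x : V2) : R := x ord0 ord0.
Let x2 (x : V2) : R := x ord0 ord_max.
Definition quadrant : set V2 := [set x | 0 < x ord0 ord0 /\ 0 < x ord0 ord_max].

Definition parameter (kap : R) (x : V2) : R * R := (kap ^+ 2, x ord0 ord0 * P R1).

Definition characteristic (kap : R) (x : V2) : R :=
  chi (parameter kap x) (x ord0 ord_max * P R2).

(** Index 0 carries the value 0, a lower end below all resonances from which the induction in
    [enumerated_continuous] starts. *)
Definition resonance (p : nat) (x : V2) : R :=
  if p is 0 then 0 else k p (x ord0 ord0) (x ord0 ord_max).

Lemma resonancesP (x : V2) (kap : R) : 0 < kap ->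
  resonances d l R1 R2 (x ord0 ord0) (x ord0 ord_max) kap <-> characteristic kap x = 0.
Proof.
move=> k0; split=> [[_ [u /eigenfunction_multiple[_ _ //]]]|h].
split=> //; exists (U (parameter kap x)).
apply: (system_radial_eigenfunction hd hR1 hR12 (UV (parameter kap x))).
- by rewrite Va Ua mulr1.
- by move: h; rewrite /characteristic /char_fun => h; lra.
- by rewrite Ua oner_neq0.
Qed.

Lemma quadrant_open : open quadrant.
Proof.
have -> : quadrant = [set x : V2 | 0 < x ord0 ord0] `&` [set x : V2 | 0 < x ord0 ord_max] by [].
apply: openI.
  apply: (@open_comp _ _ (fun x : V2 => x ord0 ord0) [set z : R | 0 < z]).
    by move=> x _; exact: coord_continuous.
  exact: open_gt.
apply: (@open_comp _ _ (fun x : V2 => x ord0 ord_max) [set z : R | 0 < z]).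
  by move=> x _; exact: coord_continuous.
exact: open_gt.
Qed.

Lemma resonance_lt x p : quadrant x -> resonance p x < resonance p.+1 x.
Proof.
move=> [h1 h2]; have [hlt hS] := hk h1 h2.
case: p => [|p] /=; last exact: hlt.
have : resonances d l R1 R2 (x ord0 ord0) (x ord0 ord_max) (k 1 (x ord0 ord0) (x ord0 ord_max)).
  by rewrite hS; exists 1%N.
by case.
Qed.

Lemma resonance_zero x (kap : R) : quadrant x -> 0 < kap ->
  characteristic kap x = 0 <-> exists2 p : nat, (0 < p)%N & resonance p x = kap.
Proof.
move=> [h1 h2] k0; rewrite -resonancesP//; have [_ ->] := hk h1 h2.
split=> [[[//|p] _ <-]|[[//|p] _ <-]]; first by exists p.+1.
by exists p.+1.
Qed.

Let snd_coord (kap : R) (x : V2) i :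
  (fun q : R * V2 => q.2 ord0 i) @ (kap, x) --> x ord0 i.
Proof.
exact: (cvg_comp _ _ (@cvg_snd _ _ (nbhs kap) (nbhs x) _) (@coord_continuous R 1 2 ord0 i x)).
Qed.

Lemma parameter_continuous : continuous (fun q : R * V2 => parameter q.1 q.2).
Proof.
move=> [kap x].
have c1 : (fun q : R * V2 => q.1 ^+ 2) @ (kap, x) --> kap ^+ 2.
  have -> : (fun q : R * V2 => q.1 ^+ 2) = (fun q => q.1 * q.1).
    by apply/funext => q; rewrite expr2.
  by rewrite expr2; apply: cvgM; exact: cvg_fst.
have c2 : (fun q : R * V2 => q.2 ord0 ord0 * P R1) @ (kap, x) --> x ord0 ord0 * P R1.
  by apply: cvgM; [exact: snd_coord|exact: cvg_cst].
exact: (cvg_pair c1 c2).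
Qed.

Lemma characteristic_continuous :
  continuous (fun q : R * V2 => characteristic q.1 q.2).
Proof.
have [M [PM PVM QM]] := coefficients_bounded d l hR1 hR12.
move=> [kap x]; have cp := @parameter_continuous (kap, x).
have cUb : (fun q : R * V2 => U (parameter q.1 q.2) R2) @ (kap, x)
    --> U (parameter kap x) R2.
  exact: (cvg_comp _ _ cp (@U_right_continuous _ _ _ _ _ _ hR12 P0 PM PVM QM _ _ cU UV Ua Va _)).
have cVb : (fun q : R * V2 => V (parameter q.1 q.2) R2) @ (kap, x)
    --> V (parameter kap x) R2.
  exact: (cvg_comp _ _ cp (@V_right_continuous _ _ _ _ _ _ hR12 P0 PM PVM QM _ _ cU UV Ua Va _)).
have cc : (fun q : R * V2 => q.2 ord0 ord_max * P R2) @ (kap, x) --> x ord0 ord_max * P R2.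
  by apply: cvgM; [exact: snd_coord|exact: cvg_cst].
by apply: cvgD => //; exact: cvgM.
Qed.

Lemma characteristic0_neq0 x : quadrant x -> characteristic 0 x != 0.
Proof.
move=> [h1 h2]; rewrite /characteristic /parameter expr0n/=.
apply: (char_fun0_neq0 hR12 P0 Q0 UV Ua Va).
  by rewrite mulr_gt0// P0.
by rewrite mulr_ge0// ltW// P0.
Qed.

(** Three special cases follow: equal x and two zeros give uniqueness, equal x and one zero gives
    the sign change, two zeros at different x give the difference quotient. *)
Lemma characteristic_identity kap kap' x y :
  characteristic kap x * U (parameter kap' y) R2
  - U (parameter kap x) R2 * characteristic kap' y
  - (x2 x - x2 y) * P R2 * (U (parameter kap x) R2 * U (parameter kap' y) R2)
  - (x1 x - x1 y) * P R1 =
  - (kap ^+ 2 - kap' ^+ 2) * ip (parameter kap x) (parameter kap' y).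
Proof.
have := char_fun_identity hR12 cP P0 cU UV Ua Va (parameter kap x) (parameter kap' y)
  (x2 x * P R2) (x2 y * P R2).
by rewrite /= -!mulrBl.
Qed.

Lemma inner_parameter_cvg (kap : R) (x : V2) :
  (fun q : (R * V2) * (R * V2) => ip (parameter q.1.1 q.1.2) (parameter q.2.1 q.2.2))
    @ ((kap, x), (kap, x)) --> ip (parameter kap x) (parameter kap x).
Proof.
have [M [PM PVM QM]] := coefficients_bounded d l hR1 hR12.
have cp := @parameter_continuous (kap, x).
set X := (kap, x).
have c1 : (fun q : (R * V2) * (R * V2) => parameter q.1.1 q.1.2) @ (X, X)
    --> parameter kap x.
  exact: (cvg_comp _ _ (@cvg_fst _ _ (nbhs X) (nbhs X) _) cp).
have c2 : (fun q : (R * V2) * (R * V2) => parameter q.2.1 q.2.2) @ (X, X)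
    --> parameter kap x.
  exact: (cvg_comp _ _ (@cvg_snd _ _ (nbhs X) (nbhs X) _) cp).
have c3 := @inner_continuous _ _ _ _ _ _ hR12 cP P0 PM PVM QM _ _ cU UV Ua Va
  (parameter kap x, parameter kap x).
have c4 : (fun q : (R * V2) * (R * V2) =>
    (parameter q.1.1 q.1.2, parameter q.2.1 q.2.2)) @ (X, X)
    --> (parameter kap x, parameter kap x) by exact: cvg_pair c1 c2.
exact: (cvg_comp _ _ c4 c3).
Qed.

(** Positivity on the diagonal spreads by joint continuity; one neighbourhood of [x] serves all [h],
    [h'] at once. *)
Lemma inner_parameter_near (kap : R) (x : V2) :
  exists2 dl : R, 0 < dl & \forall y \near x, forall h h' : R,
    `|h - kap| < dl -> `|h' - kap| < dl -> 0 < ip (parameter h y) (parameter h' y).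
Proof.
have i0 : 0 < ip (parameter kap x) (parameter kap x).
  exact: (@inner_gt0 _ _ _ _ hR12 cP P0 _ cU Ua).
have := (cvgr_gt _ (@inner_parameter_cvg kap x)) _ i0.
move=> [[A B] /= [[[A1 A2] /= [a1 a2] ha] [[B1 B2] /= [b1 b2] hb]] hAB].
have [dl /= dl0 hdl] := (nbhs_ballP _ _).1 (filterI a1 b1).
exists dl => //; near=> y => h h' hh hh'.
have [ya yb] : A2 y /\ B2 y by split; near: y.
have [hA _] : (A1 `&` B1) h by apply: hdl; rewrite -ball_normE/= distrC.
have [_ hB] : (A1 `&` B1) h' by apply: hdl; rewrite -ball_normE/= distrC.
apply: (hAB ((h, y), (h', y))); split; [exact: (ha (h, y))|exact: (hb (h', y))].
Unshelve. all: by end_near. Qed.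

(** The identity reduces to (h^2 - h'^2) times a positive inner product being 0. The radius is at
    most [k0], so both zeros are positive and h = -h' is excluded. *)
Lemma characteristic_unique (x0 : V2) (k0 : R) : quadrant x0 -> 0 < k0 ->
  characteristic k0 x0 = 0 ->
  exists2 dl : R, 0 < dl & \forall x \near x0, forall h h' : R,
    `|h - k0| < dl -> `|h' - k0| < dl ->
    characteristic h x = 0 -> characteristic h' x = 0 -> h = h'.
Proof.
move=> _ k00 _; have [dl dl0 hdl] := inner_parameter_near k0 x0.
exists (Num.min dl k0); first by rewrite lt_min dl0.
near=> x => h h'; rewrite !lt_min => /andP[h1 h2] /andP[h1' h2'] c c'.
have hx : forall h h' : R, `|h - k0| < dl -> `|h' - k0| < dl ->
  0 < ip (parameter h x) (parameter h' x) by near: x.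
have := characteristic_identity h h' x x.
rewrite c c' !subrr !mul0r mulr0 !subr0 => /esym/eqP.
rewrite mulf_eq0 [X in _ || X]gt_eqF ?hx// orbF oppr_eq0 subr_eq0 eqf_sqr => /orP[/eqP//|/eqP].
move: h2 h2'; rewrite !ltr_norml => /andP[q1 q2] /andP[q3 q4]; lra.
Unshelve. all: by end_near. Qed.

(** With u = U(R2) at [k0], u times the characteristic function at h is (k0^2 - h^2) times a
    positive inner product. The unknown sign of u disappears in the product of the two values. *)
Lemma characteristic_sign (x0 : V2) (k0 : R) : quadrant x0 -> 0 < k0 ->
  characteristic k0 x0 = 0 ->
  exists2 dl : R, 0 < dl & forall e : R, 0 < e -> e < dl ->
    characteristic (k0 - e) x0 * characteristic (k0 + e) x0 < 0.
Proof.
move=> _ k00 c0; have [dl dl0 hdl] := inner_parameter_near k0 x0.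
exists (Num.min dl k0); first by rewrite lt_min dl0.
move=> e e0; rewrite lt_min => /andP[e1 e2].
have hx : forall h h' : R, `|h - k0| < dl -> `|h' - k0| < dl ->
  0 < ip (parameter h x0) (parameter h' x0) by exact: nbhs_singleton hdl.
set u := U (parameter k0 x0) R2.
have key h : `|h - k0| < dl -> u * characteristic h x0 =
    (k0 ^+ 2 - h ^+ 2) * ip (parameter k0 x0) (parameter h x0).
  move=> _; have := characteristic_identity k0 h x0 x0.
  rewrite c0 !subrr !mul0r !subr0 sub0r -/u => h1; lra.
have n0 : `|k0 - k0| < dl by rewrite subrr normr0.
have n1 : `|k0 - e - k0| < dl by rewrite addrAC subrr sub0r normrN gtr0_norm.
have n2 : `|k0 + e - k0| < dl by rewrite addrAC subrr add0r gtr0_norm.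
have k1 := key _ n1; have k2 := key _ n2.
have p1 : 0 < u * characteristic (k0 - e) x0.
  by rewrite k1 mulr_gt0 ?hx//; nra.
have p2 : u * characteristic (k0 + e) x0 < 0.
  rewrite k2 pmulr_llt0 ?hx//; nra.
have p3 : (u * characteristic (k0 - e) x0) * (u * characteristic (k0 + e) x0) < 0.
  by rewrite pmulr_rlt0.
rewrite ltNge; apply/negP => c.
have : 0 <= u ^+ 2 * (characteristic (k0 - e) x0 * characteristic (k0 + e) x0).
  by rewrite mulr_ge0// sqr_ge0.
move: p3; have -> : u * characteristic (k0 - e) x0 * (u * characteristic (k0 + e) x0) =
  u ^+ 2 * (characteristic (k0 - e) x0 * characteristic (k0 + e) x0) by ring.
by move=> /lt_le_trans h /h; rewrite ltxx.
Qed.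

Lemma resonance_continuous p (x0 : V2) : quadrant x0 ->
  resonance p x @[x --> x0] --> resonance p x0.
Proof.
apply: (enumerated_continuous quadrant_open characteristic_continuous
  characteristic0_neq0 characteristic_unique characteristic_sign) => //.
- by move=> x q; exact: resonance_lt.
- by move=> x kap; exact: resonance_zero.
Qed.

Lemma resonance_gt0 p x : quadrant x -> (0 < p)%N -> 0 < resonance p x.
Proof.
by move=> qx p0; apply: (enumerated_gt0 (K := resonance) (W := quadrant)) => // y q; exact: resonance_lt.
Qed.

Lemma resonance_characteristic p x : quadrant x -> (0 < p)%N ->
  characteristic (resonance p x) x = 0.
Proof.
by move=> qx p0; apply/(resonance_zero qx); [exact: resonance_gt0|exists p].
Qed.

End Resonances.

(** * Difference quotients of the resonances *)

Section ResonanceQuotient.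
Variables (R : realType) (d l : nat) (R1 R2 : R) (k : nat -> R -> R -> R).
Hypotheses (hd : (2 <= d)%N) (hR1 : 0 < R1) (hR12 : R1 < R2)
  (hk : is_resonance_family d l R1 R2 k).
Variables (U V : R * R -> R -> R).
Local Notation P := (weight d R1 R2).
Local Notation Q := (potential d l R1 R2).
Hypotheses (cU : forall t, continuous (U t))
  (UV : forall t, radial_system R1 R2 P Q t.1 (U t) (V t))
  (Ua : forall t, U t R1 = 1) (Va : forall t, V t R1 = t.2).
Local Notation V2 := 'rV[R]_2.
Local Notation ip := (inner R1 R2 P U).
Local Notation res := (resonance k).
Local Notation par := (parameter d R1 R2).

Let P0 := weight_gt0 d hR1 hR12.
Let cP : continuous P. Proof. exact: weight_continuous. Qed.
Let inb : R2 \in `[R1, R2]. Proof. by rewrite in_itv/= lexx ltW. Qed.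

(** The factor of [res p x - res p y] in the Wronskian identity; on the diagonal it is 2 k times the
    squared weighted norm of the solution. *)
Let den p (x y : V2) : R := (res p x + res p y) * ip (par (res p x) x) (par (res p y) y).

(* The coefficients of [x - y] in [res p x - res p y], read off the Wronskian
   identity. *)
Definition quotient1 p (x y : V2) : R := P R1 / den p x y.

Definition quotient2 p (x y : V2) : R :=
  P R2 * (U (par (res p x) x) R2 * U (par (res p y) y) R2) / den p x y.

Let den_gt0 p x : quadrant x -> (0 < p)%N -> 0 < den p x x.
Proof.
move=> qx p0; rewrite /den mulr_gt0//; last exact: (@inner_gt0 _ _ _ _ hR12 cP P0 _ cU Ua).
by rewrite addr_gt0// (resonance_gt0 hk).
Qed.

Let rescont p (x : V2) : quadrant x -> res p z @[z --> x] --> res p x.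
Proof. exact: (resonance_continuous hd hR1 hR12 hk cU UV Ua Va). Qed.

Let par_cvg p (x : V2) : quadrant x ->
  (fun z : V2 => par (res p z) z) @ x --> par (res p x) x.
Proof.
move=> qx.
have c1 : (fun z : V2 => (res p z, z)) @ x --> (res p x, x).
  exact: (cvg_pair (rescont qx) cvg_id).
exact: (cvg_comp _ _ c1 (@parameter_continuous R d R1 R2 (res p x, x))).
Qed.

Let diag_fst (g : V2 -> R) (x : V2) : g z @[z --> x] --> g x ->
  (fun q : V2 * V2 => g q.1) @ (x, x) --> g x.
Proof. exact: (cvg_comp _ _ (@cvg_fst _ _ (nbhs x) (nbhs x) _)). Qed.

Let diag_snd (g : V2 -> R) (x : V2) : g z @[z --> x] --> g x ->
  (fun q : V2 * V2 => g q.2) @ (x, x) --> g x.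
Proof. exact: (cvg_comp _ _ (@cvg_snd _ _ (nbhs x) (nbhs x) _)). Qed.

Let den_cvg p (x : V2) : quadrant x ->
  (fun q : V2 * V2 => den p q.1 q.2) @ (x, x) --> den p x x.
Proof.
move=> qx.
have [M [PM PVM QM]] := coefficients_bounded d l hR1 hR12.
have cp := @par_cvg p x qx.
have c1 : (fun q : V2 * V2 => par (res p q.1) q.1) @ (x, x) --> par (res p x) x.
  exact: (cvg_comp _ _ (@cvg_fst _ _ (nbhs x) (nbhs x) _) cp).
have c2 : (fun q : V2 * V2 => par (res p q.2) q.2) @ (x, x) --> par (res p x) x.
  exact: (cvg_comp _ _ (@cvg_snd _ _ (nbhs x) (nbhs x) _) cp).
have c3 := @inner_continuous _ _ _ _ _ _ hR12 cP P0 PM PVM QM _ _ cU UV Ua Va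
  (par (res p x) x, par (res p x) x).
have c4 : (fun q : V2 * V2 => (par (res p q.1) q.1, par (res p q.2) q.2)) @ (x, x)
    --> (par (res p x) x, par (res p x) x) by exact: cvg_pair c1 c2.
have c5 : (fun q : V2 * V2 => ip (par (res p q.1) q.1) (par (res p q.2) q.2)) @ (x, x)
    --> ip (par (res p x) x) (par (res p x) x) by exact: (cvg_comp _ _ c4 c3).
by apply: cvgM => //; apply: cvgD; [exact/diag_fst/rescont|exact/diag_snd/rescont].
Qed.

Lemma quotient1_cvg p (x : V2) : quadrant x -> (0 < p)%N ->
  (fun q : V2 * V2 => quotient1 p q.1 q.2) @ (x, x) --> quotient1 p x x.
Proof.
move=> qx p0; apply: cvgM; first exact: cvg_cst.
by apply: cvgV; [rewrite gt_eqF// den_gt0|exact: den_cvg].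
Qed.

Lemma quotient2_cvg p (x : V2) : quadrant x -> (0 < p)%N ->
  (fun q : V2 * V2 => quotient2 p q.1 q.2) @ (x, x) --> quotient2 p x x.
Proof.
move=> qx p0; apply: cvgM; last first.
  by apply: cvgV; [rewrite gt_eqF// den_gt0|exact: den_cvg].
have [M [PM PVM QM]] := coefficients_bounded d l hR1 hR12.
have cu : (fun z : V2 => U (par (res p z) z) R2) @ x --> U (par (res p x) x) R2.
  exact: (cvg_comp _ _ (@par_cvg p x qx)
    (@U_right_continuous _ _ _ _ _ _ hR12 P0 PM PVM QM _ _ cU UV Ua Va _)).
apply: cvgM; first exact: cvg_cst.
by apply: cvgM; [exact: (diag_fst cu)|exact: (diag_snd cu)].
Qed.

(** At two resonances both characteristic terms of the identity vanish, and the difference of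
    squares is factored. Division by [den] is possible because it stays positive near the diagonal
    point. *)
Lemma resonance_quotient p (x : V2) : quadrant x -> (0 < p)%N ->
  \forall y \near x & z \near x, res p y - res p z =
    (y ord0 ord0 - z ord0 ord0) * quotient1 p y z
    + (y ord0 ord_max - z ord0 ord_max) * quotient2 p y z.
Proof.
move=> qx p0.
have nq : \forall y \near x, quadrant y.
  by apply: open_nbhs_nbhs; split => //; exact: quadrant_open.
have [[A B] /= [Ax Bx] hAB] := cvgr_gt _ (@den_cvg p x qx) _ (den_gt0 qx p0).
exists (A `&` @quadrant R, B `&` @quadrant R); first by split; exact: filterI.
move=> [y z] /= [[Ay qy] [Bz qz]].
have dyz : 0 < den p y z by exact: (hAB (y, z)).
have := characteristic_identity hR1 hR12 cU UV Ua Va (res p y) (res p z) y z.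
rewrite !(resonance_characteristic hd hR1 hR12 hk UV Ua Va)// mul0r mulr0 !sub0r => h.
apply: (mulIf (lt0r_neq0 dyz)).
have -> : (res p y - res p z) * den p y z = (res p y ^+ 2 - res p z ^+ 2) *
  ip (par (res p y) y) (par (res p z) z) by rewrite /den; ring.
have dn := lt0r_neq0 dyz.
rewrite /quotient1 /quotient2; move: (den p y z) dn => D dn.
set u := U (par (res p y) y) R2 in h *; set v := U (par (res p z) z) R2 in h *.
apply: (@etrans _ _ ((y ord0 ord0 - z ord0 ord0) * P R1 +
  (y ord0 ord_max - z ord0 ord_max) * (P R2 * (u * v)))); first lra.
by field.
Qed.

Variables p q : nat.
Hypotheses (hp : (0 < p)%N) (hq : (0 < q)%N).

(** Transposed because the increment is a row vector multiplied on the right. *)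
Definition two_frequency_quotient (x y : V2) : 'M[R]_2 :=
  (mx2 (quotient1 p x y) (quotient2 p x y) (quotient1 q x y) (quotient2 q x y))^T.

Lemma two_frequency_difference_quotient (x : V2) : quadrant x ->
  difference_quotient (two_frequency_map k p q) two_frequency_quotient x.
Proof.
move=> qx; split.
  have [[A B] /= [Ax Bx] hAB] := filterI (resonance_quotient qx hp) (resonance_quotient qx hq).
  exists (A, B) => // -[y z] /= [Ay Bz].
  have [/= hy hz] := hAB (y, z) (conj Ay Bz).
  have resE n (w : V2) : (0 < n)%N -> res n w = k n (w ord0 ord0) (w ord0 ord_max).
    by case: n.
  rewrite !resE// in hy hz.
  apply/rowP => j; rewrite !mxE big_ord_recl big_ord1 !mxE.
  have -> : lift ord0 ord0 = ord_max :> 'I_2 by apply/val_inj.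
  by case: ifP => _ /=.
apply: mx_cvg => i j.
have -> : (fun w : V2 * V2 => two_frequency_quotient w.1 w.2 i j) =
  (fun w : V2 * V2 => if j == ord0 then
     (if i == ord0 then quotient1 p w.1 w.2 else quotient2 p w.1 w.2)
   else (if i == ord0 then quotient1 q w.1 w.2 else quotient2 q w.1 w.2)).
  by apply/funext => w; rewrite !mxE.
rewrite !mxE; case: ifP => _; case: ifP => _.
- exact: quotient1_cvg.
- exact: quotient2_cvg.
- exact: quotient1_cvg.
- exact: quotient2_cvg.
Qed.

(** The normalisation says u(R1)^2 = 1 / [ip t t], so each mass is P U^2 / [ip t t] at the endpoint,
    while [den] on the diagonal equals 2 k [ip t t]. *)
Lemma boundary_mass_quotient n (a1 a2 : R) (u : R -> R) : 0 < a1 -> 0 < a2 ->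
  (0 < n)%N ->
  normalised_eigenfunction d l R1 R2 a1 a2 (k n a1 a2 ^+ 2) u ->
  boundary_mass d R1 u / (2 * k n a1 a2) = quotient1 n (row2 a1 a2) (row2 a1 a2) /\
  boundary_mass d R2 u / (2 * k n a1 a2) = quotient2 n (row2 a1 a2) (row2 a1 a2).
Proof.
move=> h1 h2 n0 [eu nu].
have [e0 he _] := eigenfunction_multiple hd hR1 hR12 UV Ua Va eu.
set x := row2 a1 a2.
have x1 : x ord0 ord0 = a1 by rewrite mxE.
have x2 : x ord0 ord_max = a2 by rewrite mxE.
have qx : quadrant x by rewrite /quadrant/= x1 x2.
have resx : res n x = k n a1 a2 by case: n n0 {eu nu he} => //= n _; rewrite x1 x2.
have parx : par (res n x) x = (k n a1 a2 ^+ 2, a1 * P R1) by rewrite /parameter resx x1.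
have k0 : 0 < k n a1 a2 by rewrite -resx (resonance_gt0 hk).
set t := (k n a1 a2 ^+ 2, a1 * P R1) in he parx.
have ina : R1 \in `[R1, R2] by rewrite in_itv/= lexx ltW.
have norm1 : u R1 ^+ 2 * ip t t = 1.
  rewrite -nu /inner.
  have cf : continuous (fun r => P r * (U t r * U t r)).
    by move=> z; apply: cvgM; [exact: cP|apply: cvgM; exact: cU].
  have cg : continuous (fun r => u R1 ^+ 2 * (P r * (U t r * U t r))).
    by move=> z; apply: cvgM; [exact: cvg_cst|exact: cf].
  have -> : \int[lebesgue_measure]_(r in `[R1, R2]) (`|u r| ^+ 2 * r ^+ d.-1) =
    \int[lebesgue_measure]_(r in `[R1, R2]) (u R1 ^+ 2 * (P r * (U t r * U t r))).
    apply: eq_Rintegral => r; rewrite inE => rab.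
    rewrite real_normK ?num_real// weightE// (he r rab); ring.
  rewrite (Rintegral_primitive hR12 cg).
  have := @constant_of_derive0 _ (fun r => u R1 ^+ 2 * primitive R1 R2 (fun r => P r * (U t r * U t r)) r
    - primitive R1 R2 (fun r => u R1 ^+ 2 * (P r * (U t r * U t r))) r) R1 R2 _ _ R2 inb.
  rewrite !primitive_left// mulr0 subrr => h.
  apply/eqP; rewrite -subr_eq0; apply/eqP; apply: h.
    move=> r rab.
    have h3 := is_derive_subf (is_derive_cmulf (u R1 ^+ 2) (primitive_derive cf rab))
      (primitive_derive cg rab).
    by apply: (is_derive_eq h3); rewrite subrr.
  apply: continuous_subspaceT => r; apply: cvgB; last exact: primitive_continuous.
  by apply: cvgM; [exact: cvg_cst|exact: primitive_continuous].
have ip0 : 0 < ip t t by exact: (@inner_gt0 _ _ _ _ hR12 cP P0 _ cU Ua).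
have u1E : u R1 ^+ 2 = (ip t t)^-1.
  by apply: (mulIf (lt0r_neq0 ip0)); rewrite norm1 mulVf// lt0r_neq0.
have bm r : r \in `[R1, R2] -> boundary_mass d r u = P r * (U t r * U t r) / ip t t.
  move=> rab; rewrite /boundary_mass real_normK ?num_real// (he r rab) weightE//.
  rewrite exprMn u1E; ring.
rewrite /quotient1 /quotient2 /den parx resx !bm// Ua.
have kn : k n a1 a2 != 0 by rewrite gt_eqF.
have ipn : ip t t != 0 by rewrite gt_eqF.
by split; field; rewrite kn ipn andbT gt_eqF ?addr_gt0.
Qed.

End ResonanceQuotient.

(** * Recovery error *)

Section EuclideanNorm.
Variable R : realType.

Lemma norm2_ge0 n (x : 'cV[R]_n) : 0 <= norm2 x.
Proof. exact: sqrtr_ge0. Qed.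

Lemma norm2Z n (c : R) (x : 'cV[R]_n) : norm2 (c *: x) = `|c| * norm2 x.
Proof.
rewrite /norm2 -sqrtr_sqr -sqrtrM ?sqr_ge0//; congr Num.sqrt.
by rewrite mulr_sumr; apply: eq_bigr => i _; rewrite mxE exprMn.
Qed.

Lemma norm_le_norm2 n (x : 'cV[R]_n) : `|x| <= norm2 x.
Proof.
apply: mx_norm_le; first exact: norm2_ge0.
move=> i j; rewrite ord1 -sqrtr_sqr ler_wsqrtr// (bigD1 i)//= lerDl.
by apply: sumr_ge0 => *; exact: sqr_ge0.
Qed.

Lemma norm2_le_norm n (x : 'cV[R]_n) : norm2 x <= Num.sqrt n%:R * `|x|.
Proof.
rewrite -[X in _ * X]normr_id -sqrtr_sqr -sqrtrM// ler_wsqrtr//.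
rewrite -[n in n%:R]card_ord -sumr_const mulr_suml; apply: ler_sum => i _.
rewrite mul1r -[leLHS]real_normK ?num_real//.
by rewrite ler_pXn2r ?nnegrE// mx_norm_entry.
Qed.

(** Makes [opnorm2 A] a genuine supremum; the bound passes through the maximum norm and is not
    sharp. *)
Lemma opnorm2_has_sup m n (A : 'M[R]_(m, n)) :
  has_sup [set norm2 (A *m x) | x in [set x : 'cV[R]_n | norm2 x <= 1]].
Proof.
split; first by exists (norm2 (A *m 0)), 0 => //=; rewrite -(scale0r 0) norm2Z normr0 mul0r.
exists (Num.sqrt m%:R * (n%:R * `|A| * 1)) => _ [x /= x1 <-].
apply: le_trans (norm2_le_norm _) _; rewrite ler_wpM2l ?sqrtr_ge0//.
apply: le_trans (mulmx_norm _ _) _; rewrite ler_wpM2l ?mulr_ge0//.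
exact: le_trans (norm_le_norm2 x) x1.
Qed.

Lemma opnorm2_ge0 m n (A : 'M[R]_(m, n)) : 0 <= opnorm2 A.
Proof.
have := @sup_upper_bound _ _ (opnorm2_has_sup A) (norm2 (A *m 0)).
move=> h; apply: le_trans (norm2_ge0 (A *m 0)) (h _).
by exists 0 => //=; rewrite -(scale0r 0) norm2Z normr0 mul0r.
Qed.

(** By homogeneity it suffices to treat unit vectors; the zero vector is handled apart. *)
Lemma norm2_mulmx_le m n (A : 'M[R]_(m, n)) (x : 'cV[R]_n) :
  norm2 (A *m x) <= opnorm2 A * norm2 x.
Proof.
have [x0|x0] := eqVneq (norm2 x) 0.
  have -> : x = 0.
    by apply/eqP; rewrite -normr_le0 -x0 norm_le_norm2.
  by rewrite mulmx0 -(scale0r 0) norm2Z normr0 mul0r mulr_ge0 ?opnorm2_ge0 ?norm2_ge0.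
have xgt0 : 0 < norm2 x by rewrite lt_neqAle eq_sym x0 norm2_ge0.
rewrite -ler_pdivrMr//.
have -> : norm2 (A *m x) / norm2 x = norm2 (A *m ((norm2 x)^-1 *: x)).
  by rewrite -scalemxAr norm2Z ger0_norm ?invr_ge0 ?norm2_ge0// mulrC.
apply: (sup_upper_bound (opnorm2_has_sup A)); exists ((norm2 x)^-1 *: x) => //=.
by rewrite norm2Z ger0_norm ?invr_ge0 ?norm2_ge0// mulVf.
Qed.

Lemma det_mx2 (x y z t : R) : \det (mx2 x y z t) = x * t - y * z.
Proof.
rewrite (expand_det_row _ ord0) big_ord_recl big_ord1 /cofactor !det_mx11 !mxE /=.
by rewrite expr0 expr1; ring.
Qed.

End EuclideanNorm.

Theorem proposition5p2 (R : realType) (d l : nat) (R1 R2 a1 a2 : R)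
    (k : nat -> R -> R -> R) (p q : nat) (u1 u2 : R -> R)
    (hd : (2 <= d)%N) (hR1 : 0 < R1) (hR12 : R1 < R2)
    (ha1 : 0 < a1) (ha2 : 0 < a2)
    (hk : is_resonance_family d l R1 R2 k)
    (hp : (0 < p)%N) (hq : (0 < q)%N) (hpq : p <> q)
    (hu1 : normalised_eigenfunction d l R1 R2 a1 a2 (k p a1 a2 ^+ 2) u1)
    (hu2 : normalised_eigenfunction d l R1 R2 a1 a2 (k q a1 a2 ^+ 2) u2) :
  let k1 := k p a1 a2 in
  let k2 := k q a1 a2 in
  let b11 := boundary_mass d R1 u1 in
  let b21 := boundary_mass d R2 u1 in
  let b12 := boundary_mass d R1 u2 in
  let b22 := boundary_mass d R2 u2 in
  let F := two_frequency_map k p q in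
  let a := row2 a1 a2 in
  let J := Jacobian_matrix F a in
  [/\ (differentiable F a /\
       J = mx2 (b11 / (2 * k1)) (b21 / (2 * k1))
               (b12 / (2 * k2)) (b22 / (2 * k2))),
      (locally_invertible F a <-> b11 * b22 <> b21 * b12),
      (forall (eta : R) (dk da : 'cV[R]_2),
         norm2 dk <= eta -> J \in unitmx -> dk = J *m da ->
         norm2 da <= opnorm2 (invmx J) * eta) &
      (forall (eps : R) (dk : 'cV[R]_2),
         `|dk ord0 ord0| <= eps * `|k1| -> `|dk ord_max ord0| <= eps * `|k2| ->
         norm2 dk <= eps * Num.sqrt (k1 ^+ 2 + k2 ^+ 2))].
Proof.
move=> k1 k2 b11 b21 b12 b22 F a J.
have a1E : a ord0 ord0 = a1 by rewrite mxE.
have a2E : a ord0 ord_max = a2 by rewrite mxE.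
have qa : quadrant a by rewrite /quadrant/= a1E a2E.
have k10 : 0 < k1.
  have := resonance_gt0 hk qa hp.
  by rewrite /k1; case: (p) hp => //= n _; rewrite a1E a2E.
have k20 : 0 < k2.
  have := resonance_gt0 hk qa hq.
  by rewrite /k2; case: (q) hq => //= n _; rewrite a1E a2E.
have P0 := weight_gt0 d hR1 hR12.
have [M [PM PVM QM]] := coefficients_bounded d l hR1 hR12.
have ivp (t : R * R) : exists uv : (R -> R) * (R -> R),
    [/\ continuous uv.1, continuous uv.2,
        radial_system R1 R2 (weight d R1 R2) (potential d l R1 R2) t.1 uv.1 uv.2,
        uv.1 R1 = 1 & uv.2 R1 = t.2].
  have [u [v h]] := initial_value_problem hR12
    (@weight_continuous R d R1 R2) (@potential_weight_continuous R d l R1 R2 hR1 hR12) P0 PM PVM QM t.1 t.2.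
  by exists (u, v).
(* Choice selects one solution for every pair [t], which provides the families [U] and [V]. *)
have [f hf] := choice ivp.
pose U t := (f t).1; pose V t := (f t).2.
have cU t : continuous (U t) by case: (hf t).
have UV t : radial_system R1 R2 (weight d R1 R2) (potential d l R1 R2) t.1 (U t) (V t).
  by case: (hf t).
have Ua t : U t R1 = 1 by case: (hf t).
have Va t : V t R1 = t.2 by case: (hf t).
pose G := two_frequency_quotient d R1 R2 k U p q.
have dq x : quadrant x -> difference_quotient F G x.
  exact: (two_frequency_difference_quotient hd hR1 hR12 hk cU UV Ua Va hp hq).
have [dF _] := difference_quotient_diff (dq a qa).
have JG : J = (G a a)^T by exact: difference_quotient_Jacobian (dq a qa).
have [e11 e21] := boundary_mass_quotient hd hR1 hR12 hk cU UV Ua Va ha1 ha2 hp hu1.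
have [e12 e22] := boundary_mass_quotient hd hR1 hR12 hk cU UV Ua Va ha1 ha2 hq hu2.
have JE : J = mx2 (b11 / (2 * k1)) (b21 / (2 * k1)) (b12 / (2 * k2)) (b22 / (2 * k2)).
  by rewrite JG /G /two_frequency_quotient trmxK -e11 -e21 -e12 -e22.
(* The determinant is b11 b22 - b21 b12 divided by 4 k1 k2, which is positive. *)
have unitJ : J \in unitmx <-> b11 * b22 <> b21 * b12.
  rewrite JE unitmxE det_mx2 unitfE.
  have -> : b11 / (2 * k1) * (b22 / (2 * k2)) - b21 / (2 * k1) * (b12 / (2 * k2)) =
      (b11 * b22 - b21 * b12) / (4 * k1 * k2).
    by field; rewrite !gt_eqF.
  rewrite mulf_eq0 negb_or invr_eq0 !mulf_eq0 !negb_or !(gt_eqF k10, gt_eqF k20) pnatr_eq0 /= andbT.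
  by rewrite subr_eq0; split => /eqP.
split.
- by [].
- rewrite -unitJ; split; first exact: locally_invertible_unit.
  rewrite JG unitmx_tr => uG.
  exact: (inverse_function (@quadrant_open R) qa dq uG).
- move=> eta dk da hdk uJ dkE.
  have -> : da = invmx J *m dk by rewrite dkE mulKmx.
  by apply: le_trans (norm2_mulmx_le _ _) _; rewrite ler_wpM2l// opnorm2_ge0.
- move=> eps dk h1 h2.
  (* Nonnegativity of [eps] follows from the first noise bound, because [k1] is nonzero. *)
  have eps0 : 0 <= eps.
    have := le_trans (normr_ge0 _) h1; rewrite pmulr_lge0// normr_gt0.
    by rewrite gt_eqF.
  rewrite -[X in X * _](ger0_norm eps0) -sqrtr_sqr -sqrtrM ?sqr_ge0//.
  rewrite /norm2 big_ord_recl big_ord1 ler_wsqrtr//.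
  have -> : lift ord0 ord0 = ord_max :> 'I_2 by apply/val_inj.
  have sq x (c : R) : `|x| <= eps * `|c| -> x ^+ 2 <= eps ^+ 2 * c ^+ 2.
    move=> h; rewrite -[x ^+ 2]real_normK ?num_real// -[c ^+ 2]real_normK ?num_real//.
    by rewrite -exprMn ler_pXn2r ?nnegrE// mulr_ge0.
  by rewrite mulrDr lerD// sq.
Qed.
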